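(* Let $b\geq 2$ and let $C_\omega\in\mathbb R$, $C_\omega\neq0$. Suppose that the velocity field of the form $$v_R=\frac{G(x)}{r^b},\qquad v_\alpha=\frac{F(x)}{r^b},\qquad v_\theta=\frac{\Omega(x)}{r^b},\qquad x=\cos\alpha,\quad r=R\sin\alpha,$$ together with some scalar pressure $p$, is a classical solution of the steady incompressible Euler equations $$(\mathbf v\cdot\nabla)\mathbf v=-\nabla p,\qquad \nabla\cdot\mathbf v=0$$ in $\{R>0,\ 0<\alpha<\pi/2\}$, subject to the conditions $$F(0)=0,\qquad \lim_{x\to1^-}\Omega(x)=C_\omega,\qquad\text{and, if } b\neq2,\quad \lim_{x\to1^-}F(x)(1-x^2)^{(1-b)/2}=0 .$$ Then the solution is the trivial one: $F\equiv0$, $G\equiv 0$ and $\Omega\equiv C_\omega$ on $(0,1)$.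
   Context: Spherical coordinates $(R,\alpha,\theta)$ on $\mathbb R^3$: $R$ is the distance to the origin, $\alpha$ is the angle between the radius vector and the positive $z$-axis, and $\theta$ is the meridian angle about the $z$-axis; $\alpha=0$ is the vortex axis and $\alpha=\pi/2$ is the ground plane. The components $v_R,v_\alpha,v_\theta$ of $\mathbf v$ are taken with respect to the orthonormal spherical frame $(\mathbf e_R,\mathbf e_\alpha,\mathbf e_\theta)$, and $r=R\sin\alpha$ is the distance to the $z$-axis. The scaled pressure $p=p(R,\alpha,\theta)$ is a single-valued $C^1$ function, hence $2\pi$-periodic in $\theta$. ''Classical'' means that all derivatives of $F,G,\Omega$ occurring in the equations after elimination of the pressure exist and are continuous on the open interval $(0,1)$ ($F\in C^3(0,1)$, $G\in C^2(0,1)$, $\Omega\in C^1(0,1)$), and the equations hold pointwise. $F$ extends continuously to $x=0$ (with value $F(0)=0$, expressing that there is no source or sink at the ground); slip at the ground is allowed, so no condition is imposed on $G$ and $\Omega$ at $x=0$. *)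

(* Defs.v *)
From Stdlib Require Import Reals.
From Coquelicot Require Import Coquelicot.
Open Scope R_scope.

(* Points and vectors of R^3 in Cartesian coordinates. *)
Definition R3 : Type := (R * R * R)%type.

Definition cx (q : R3) : R := fst (fst q).
Definition cy (q : R3) : R := snd (fst q).
Definition cz (q : R3) : R := snd q.

Definition Dx (f : R3 -> R) (q : R3) : R :=
  Derive (fun t => f (t, cy q, cz q)) (cx q).
Definition Dy (f : R3 -> R) (q : R3) : R :=
  Derive (fun t => f (cx q, t, cz q)) (cy q).
Definition Dz (f : R3 -> R) (q : R3) : R :=
  Derive (fun t => f (cx q, cy q, t)) (cz q).

(* [D] is meant to be open: values of [f] outside [D] are then irrelevant. *)
Definition C1_on (D : R3 -> Prop) (f : R3 -> R) : Prop :=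
  forall q : R3, D q ->
    (ex_derive (fun t => f (t, cy q, cz q)) (cx q) /\
     ex_derive (fun t => f (cx q, t, cz q)) (cy q) /\
     ex_derive (fun t => f (cx q, cy q, t)) (cz q)) /\
    (continuous (Dx f) q /\ continuous (Dy f) q /\ continuous (Dz f) q).

Definition grad (f : R3 -> R) (q : R3) : R3 := (Dx f q, Dy f q, Dz f q).

Definition div (v : R3 -> R3) (q : R3) : R :=
  Dx (fun u => cx (v u)) q + Dy (fun u => cy (v u)) q
  + Dz (fun u => cz (v u)) q.

(* (v . nabla) f for a scalar function f *)
Definition advect (v : R3 -> R3) (f : R3 -> R) (q : R3) : R :=
  cx (v q) * Dx f q + cy (v q) * Dy f q + cz (v q) * Dz f q.

(* (v . nabla) v, taken on Cartesian components *)
Definition convection (v : R3 -> R3) (q : R3) : R3 :=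
  (advect v (fun u => cx (v u)) q,
   advect v (fun u => cy (v u)) q,
   advect v (fun u => cz (v u)) q).

Definition steady_euler_on (D : R3 -> Prop) (v : R3 -> R3) (p : R3 -> R)
  : Prop :=
  forall q : R3, D q -> convection v q = opp (grad p q) /\ div v q = 0.

(* The point with spherical coordinates (rho, alpha, theta), where alpha is
   the angle with the positive z-axis, and the orthonormal frame there. *)
Definition sph (rho alpha theta : R) : R3 :=
  (rho * sin alpha * cos theta, rho * sin alpha * sin theta, rho * cos alpha).

Definition e_R (alpha theta : R) : R3 :=
  (sin alpha * cos theta, sin alpha * sin theta, cos alpha).
Definition e_alpha (alpha theta : R) : R3 :=
  (cos alpha * cos theta, cos alpha * sin theta, - sin alpha).
Definition e_theta (theta : R) : R3 := (- sin theta, cos theta, 0).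

(* The set {R > 0, 0 < alpha < pi/2}: the open upper half-space minus the
   z-axis. *)
Definition flow_domain (q : R3) : Prop :=
  exists rho alpha theta : R,
    0 < rho /\ 0 < alpha < PI / 2 /\ q = sph rho alpha theta.

(* The frame vectors depend on theta only modulo 2 pi, so on [flow_domain]
   this determines v from F, G, Omega without any compatibility condition. *)
Definition has_vortex_form (b : R) (F G Omega : R -> R) (v : R3 -> R3)
  : Prop :=
  forall rho alpha theta : R, 0 < rho -> 0 < alpha < PI / 2 ->
    let x := cos alpha in
    let r := rho * sin alpha in
    v (sph rho alpha theta) =
      plus (plus (scal (G x / Rpower r b) (e_R alpha theta))
                 (scal (F x / Rpower r b) (e_alpha alpha theta)))
           (scal (Omega x / Rpower r b) (e_theta theta)).

(* C^n on the open interval (0,1). *)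
Definition Cn_01 (n : nat) (f : R -> R) : Prop :=
  forall k : nat, (k <= n)%nat -> forall x : R, 0 < x < 1 ->
    ex_derive_n f k x /\ continuous (Derive_n f k) x.

(* Under the regularity required of F, G, Omega, a field of the vortex form is
   C^1 on [flow_domain], so the total operator [Derive] applied to v in
   [steady_euler_on] always denotes a genuine derivative. *)
Definition classical_vortex_solution (b : R) (F G Omega : R -> R)
  (v : R3 -> R3) (p : R3 -> R) : Prop :=
  has_vortex_form b F G Omega v /\
  Cn_01 3 F /\ Cn_01 2 G /\ Cn_01 1 Omega /\
  C1_on flow_domain p /\
  steady_euler_on flow_domain v p.

(* Main.v *)
(** Write f = F (1-x^2)^((1-b)/2) for the Stokes stream function and
    g = Omega (1-x^2)^((1-b)/2) for the angular momentum.  Periodicity of the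
    pressure in theta removes it from the azimuthal equation, and with
    incompressibility this says, for b <> 2, that g^2 is a constant multiple of
    (f^2)^((b-1)/(b-2)) wherever f does not vanish.  Hence Omega tends to 0
    wherever f does; as Omega has the nonzero limit Comega on the axis, F must
    vanish on every interval (l,1) where Omega has no zero.  For b = 2
    incompressibility alone makes F^2/(1-x^2) constant, hence zero by F(0) = 0.
    On such an interval the azimuthal equation gives G = 0, the flow is a pure
    swirl, and eliminating the pressure gives Omega Omega' = 0, so
    Omega = Comega there.  At its last zero Omega would be both 0 and Comega,
    so Omega has no zero and l = 0 is allowed. *)

From Stdlib Require Import Reals Lra Lia Classical.
From Coquelicot Require Import Coquelicot.
Require Import Defs.
Open Scope R_scope.

(** * Differentiability along curves in R^3 *)

Lemma is_derive_eq (f : R -> R) (x l l' : R) :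
  is_derive f x l -> l = l' -> is_derive f x l'.
Proof. now intros H <-. Qed.

Lemma is_derive_Rmult (f g : R -> R) (x df dg : R) :
  is_derive f x df -> is_derive g x dg ->
  is_derive (fun t => f t * g t) x (df * g x + f x * dg).
Proof.
  intros Hf Hg. apply (is_derive_mult f g x df dg Hf Hg).
  intros; apply Rmult_comm.
Qed.

Lemma is_derive_Rcomp (f g : R -> R) (x df dg : R) :
  is_derive f (g x) df -> is_derive g x dg ->
  is_derive (fun t => f (g t)) x (df * dg).
Proof.
  intros Hf Hg.
  apply (is_derive_eq _ _ _ _ (is_derive_comp f g x df dg Hf Hg)).
  apply Rmult_comm.
Qed.

Lemma is_derive_Rplus (f g : R -> R) (x df dg : R) :
  is_derive f x df -> is_derive g x dg ->
  is_derive (fun t => f t + g t) x (df + dg).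
Proof. intros Hf Hg. exact (is_derive_plus f g x df dg Hf Hg). Qed.

Lemma is_derive_Ropp (f : R -> R) (x df : R) :
  is_derive f x df -> is_derive (fun t => - f t) x (- df).
Proof. intros Hf. exact (is_derive_opp f x df Hf). Qed.

Lemma is_derive_continuous (f : R -> R) (x df : R) :
  is_derive f x df -> continuous f x.
Proof. intros H. apply (ex_derive_continuous f). now exists df. Qed.

(* Hadamard differentiability at [q]: the chain rule holds along every curve
   through [q].  It is stable under all the operations needed here by the
   one-variable rules, and it determines the partial derivatives. *)
Definition hadamard (f : R3 -> R) (q : R3) (a b c : R) : Prop :=
  forall (X Y Z : R -> R) (t X' Y' Z' : R),
    (X t, Y t, Z t) = q ->
    is_derive X t X' -> is_derive Y t Y' -> is_derive Z t Z' ->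
    is_derive (fun s => f (X s, Y s, Z s)) t (a * X' + b * Y' + c * Z').

Definition ex_hadamard (f : R3 -> R) (q : R3) : Prop :=
  exists a b c, hadamard f q a b c.

(** Testing on the three lines through [q] parallel to the axes isolates each coefficient. *)
Lemma hadamard_partials (f : R3 -> R) (q : R3) (a b c : R) :
  hadamard f q a b c -> Dx f q = a /\ Dy f q = b /\ Dz f q = c.
Proof.
  intros H. destruct q as [[x y] z].
  unfold Dx, Dy, Dz, cx, cy, cz; simpl. repeat split; apply is_derive_unique.
  - apply is_derive_eq with (a * 1 + b * 0 + c * 0); [|ring].
    apply (H (fun s => s) (fun _ => y) (fun _ => z)); try easy;
      first [apply (is_derive_id (K := R_AbsRing)) | apply (is_derive_const (V := R_NormedModule))].
  - apply is_derive_eq with (a * 0 + b * 1 + c * 0); [|ring].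
    apply (H (fun _ => x) (fun s => s) (fun _ => z)); try easy;
      first [apply (is_derive_id (K := R_AbsRing)) | apply (is_derive_const (V := R_NormedModule))].
  - apply is_derive_eq with (a * 0 + b * 0 + c * 1); [|ring].
    apply (H (fun _ => x) (fun _ => y) (fun s => s)); try easy;
      first [apply (is_derive_id (K := R_AbsRing)) | apply (is_derive_const (V := R_NormedModule))].
Qed.

Lemma ex_hadamard_partials (f : R3 -> R) (q : R3) :
  ex_hadamard f q -> hadamard f q (Dx f q) (Dy f q) (Dz f q).
Proof.
  intros (a & b & c & H).
  now destruct (hadamard_partials f q a b c H) as (-> & -> & ->).
Qed.

Lemma ex_hadamard_cx (q : R3) : ex_hadamard cx q.
Proof.
  exists 1, 0, 0. intros X Y Z t X' Y' Z' _ HX HY HZ.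
  apply (is_derive_eq X t X'); [exact HX | ring].
Qed.

Lemma ex_hadamard_cy (q : R3) : ex_hadamard cy q.
Proof.
  exists 0, 1, 0. intros X Y Z t X' Y' Z' _ HX HY HZ.
  apply (is_derive_eq Y t Y'); [exact HY | ring].
Qed.

Lemma ex_hadamard_cz (q : R3) : ex_hadamard cz q.
Proof.
  exists 0, 0, 1. intros X Y Z t X' Y' Z' _ HX HY HZ.
  apply (is_derive_eq Z t Z'); [exact HZ | ring].
Qed.

Lemma ex_hadamard_plus (f g : R3 -> R) (q : R3) :
  ex_hadamard f q -> ex_hadamard g q -> ex_hadamard (fun u => f u + g u) q.
Proof.
  intros (a & b & c & Hf) (a' & b' & c' & Hg).
  exists (a + a'), (b + b'), (c + c'). intros X Y Z t X' Y' Z' Hq HX HY HZ.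
  eapply is_derive_eq.
  - apply is_derive_Rplus.
    + apply (Hf X Y Z t X' Y' Z'); assumption.
    + apply (Hg X Y Z t X' Y' Z'); assumption.
  - ring.
Qed.

Lemma ex_hadamard_mult (f g : R3 -> R) (q : R3) :
  ex_hadamard f q -> ex_hadamard g q -> ex_hadamard (fun u => f u * g u) q.
Proof.
  intros (a & b & c & Hf) (a' & b' & c' & Hg).
  exists (a * g q + a' * f q), (b * g q + b' * f q), (c * g q + c' * f q).
  intros X Y Z t X' Y' Z' Hq HX HY HZ.
  eapply is_derive_eq.
  - apply is_derive_Rmult.
    + apply (Hf X Y Z t X' Y' Z'); assumption.
    + apply (Hg X Y Z t X' Y' Z'); assumption.
  - simpl. rewrite Hq. ring.
Qed.

Lemma ex_hadamard_comp (h : R -> R) (f : R3 -> R) (q : R3) :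
  ex_derive h (f q) -> ex_hadamard f q -> ex_hadamard (fun u => h (f u)) q.
Proof.
  intros [d Hh] (a & b & c & Hf).
  exists (d * a), (d * b), (d * c). intros X Y Z t X' Y' Z' Hq HX HY HZ.
  eapply is_derive_eq.
  - apply (is_derive_Rcomp h (fun s => f (X s, Y s, Z s))).
    + rewrite Hq. exact Hh.
    + apply (Hf X Y Z t X' Y' Z'); assumption.
  - ring.
Qed.

Lemma continuous_pairing {T U V : UniformSpace} (f : T -> U) (g : T -> V) (t : T) :
  continuous f t -> continuous g t ->
  continuous (fun s => (f s, g s)) t.
Proof.
  intros Hf Hg. apply (continuous_comp_2 f g (fun a b => (a, b))); trivial.
  apply (continuous_ext (fun u : U * V => u)); [now intros [] | apply continuous_id].
Qed.

Lemma continuous_triple {T : UniformSpace} (X Y Z : T -> R) (t : T) :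
  continuous X t -> continuous Y t -> continuous Z t ->
  continuous (fun s => (X s, Y s, Z s) : R3) t.
Proof. intros HX HY HZ. repeat apply continuous_pairing; assumption. Qed.

(** A differentiable curve through [q] is continuous, so for nearby parameters it stays in the
    neighbourhood where the two functions agree. *)
Lemma ex_hadamard_ext_loc (f g : R3 -> R) (q : R3) :
  locally q (fun u => f u = g u) -> ex_hadamard f q -> ex_hadamard g q.
Proof.
  intros Hfg (a & b & c & Hf). exists a, b, c.
  intros X Y Z t X' Y' Z' Hq HX HY HZ.
  apply (is_derive_ext_loc (fun s => f (X s, Y s, Z s))).
  - assert (H : continuous (fun s => (X s, Y s, Z s)) t).
    { apply continuous_triple; eapply is_derive_continuous; eassumption. }
    apply (H (fun u => f u = g u)). rewrite Hq. exact Hfg.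
  - apply Hf; assumption.
Qed.

(** A two-variable chain rule along the curve ([X s], [s]). The first partial must exist near the
    point and be continuous there, the second only exist at the point; this lets coordinates be
    peeled off one at a time. *)
Lemma is_derive_diag (f : R -> R -> R) (dfx : R -> R -> R) (dfy : R)
  (X : R -> R) (t X' : R) :
  locally (X t, t) (fun u : R * R =>
    is_derive (fun z => f z (snd u)) (fst u) (dfx (fst u) (snd u))) ->
  is_derive (fun z => f (X t) z) t dfy ->
  continuous (fun u : R * R => dfx (fst u) (snd u)) (X t, t) ->
  is_derive X t X' ->
  is_derive (fun s => f (X s) s) t (dfx (X t) t * X' + dfy).
Proof.
  intros H1 H2 H3 HX.
  assert (H := is_derive_filterdiff f (X t) t dfx dfy H1 H2 H3).
  assert (K := filterdiff_comp'_2 X (fun s : R => s) f t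
    (fun y => scal y X') (fun y => y)
    (fun a b => plus (scal a (dfx (X t) t)) (scal b dfy))
    HX (filterdiff_id (locally t)) H).
  unfold is_derive. eapply filterdiff_ext_lin; [exact K|].
  intros y. unfold scal, plus; simpl. unfold mult; simpl. ring.
Qed.

(** The curve is split coordinate by coordinate: [X] is separated while [Y] and [Z] are absorbed
    into the parameter, then [Y], and what remains is the one-variable chain rule in [Z]. *)
Lemma C1_on_ex_hadamard (D : R3 -> Prop) (f : R3 -> R) (q : R3) :
  C1_on D f -> locally q D -> ex_hadamard f q.
Proof.
  intros HC HD. exists (Dx f q), (Dy f q), (Dz f q).
  intros X Y Z t X' Y' Z' Hq HX HY HZ.
  assert (CY := is_derive_continuous _ _ _ HY).
  assert (CZ := is_derive_continuous _ _ _ HZ).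
  destruct (HC q (locally_singleton _ _ HD)) as [[_ [_ Hz]] [CDx [CDy _]]].
  subst q.
  assert (Cst : continuous (fun u : R * R => Y (snd u)) (X t, t)).
  { apply (continuous_comp snd Y); [apply continuous_snd | exact CY]. }
  assert (Csz : forall a : R, continuous (fun u : R * R => Z (snd u)) (a, t)).
  { intros a. apply (continuous_comp snd Z); [apply continuous_snd | exact CZ]. }
  assert (C1 : continuous (fun u : R * R =>
      (fst u, Y (snd u), Z (snd u)) : R3) (X t, t)).
  { apply continuous_triple; [apply continuous_fst | exact Cst | apply Csz]. }
  assert (C2 : continuous (fun u : R * R =>
      (X t, fst u, Z (snd u)) : R3) (Y t, t)).
  { apply continuous_triple;
      [apply continuous_const | apply continuous_fst | apply Csz]. }
  rewrite Rplus_assoc.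
  apply (is_derive_diag (fun x s => f (x, Y s, Z s))
           (fun x s => Dx f (x, Y s, Z s))); [| | |exact HX].
  - apply (filter_imp (fun u : R * R => D (fst u, Y (snd u), Z (snd u)))); [|exact (C1 D HD)]. intros [a s] Ha; simpl in *.
    destruct (HC _ Ha) as [[E _] _]. apply (Derive_correct _ _ E).
  - apply (is_derive_diag (fun y s => f (X t, y, Z s))
           (fun y s => Dy f (X t, y, Z s))); [| | |exact HY].
    + apply (filter_imp (fun u : R * R => D (X t, fst u, Z (snd u)))); [|exact (C2 D HD)]. intros [a s] Ha; simpl in *.
      destruct (HC _ Ha) as [[_ [E _]] _]. apply (Derive_correct _ _ E).
    + apply (is_derive_Rcomp (fun z => f (X t, Y t, z)) Z); [|exact HZ].
      apply (Derive_correct _ _ Hz).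
    + apply (continuous_comp (fun u : R * R => (X t, fst u, Z (snd u)) : R3)
               (Dy f)); [exact C2 | exact CDy].
  - apply (continuous_comp (fun u : R * R => (fst u, Y (snd u), Z (snd u)) : R3)
               (Dx f)); [exact C1 | exact CDx].
Qed.

(** * The flow domain and its coordinate curves *)

(** The arccosine of x / r fixes the angle up to sign, and the sign of y selects it. *)
Lemma polar_angle (x y : R) :
  0 < x * x + y * y ->
  exists theta, x = sqrt (x * x + y * y) * cos theta /\
                y = sqrt (x * x + y * y) * sin theta.
Proof.
  intros H. set (r := sqrt (x * x + y * y)).
  assert (Hr : 0 < r) by now apply sqrt_lt_R0.
  assert (Hr2 : r * r = x * x + y * y) by (apply sqrt_sqrt; lra).
  assert (Hb : -1 <= x / r <= 1).
  { split; [apply Rle_div_r | apply Rle_div_l]; trivial; nra. }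
  assert (Hs : sin (acos (x / r)) = Rabs y / r).
  { rewrite sin_acos by exact Hb.
    replace (1 - Rsqr (x / r)) with (Rsqr (y / r)).
    - rewrite sqrt_Rsqr_abs, Rabs_div by lra. now rewrite (Rabs_pos_eq r) by lra.
    - unfold Rsqr. field_simplify; try lra. replace (r ^ 2) with (r * r) by ring.
      rewrite Hr2. field. lra. }
  destruct (Rle_dec 0 y) as [Hy|Hy].
  - exists (acos (x / r)). rewrite cos_acos, Hs, Rabs_pos_eq by assumption.
    split; field; lra.
  - exists (- acos (x / r)). rewrite cos_neg, sin_neg, cos_acos, Hs, Rabs_left by lra.
    split; field; lra.
Qed.

(** Two strict inequalities between polynomials describe the domain without angles, which makes its
    openness visible. *)
Lemma flow_domain_iff (q : R3) :
  flow_domain q <-> 0 < cz q /\ 0 < cx q * cx q + cy q * cy q.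
Proof.
  destruct q as [[x y] z]; unfold cx, cy, cz; simpl. split.
  - intros (rho & alpha & theta & Hrho & Ha & Hq). injection Hq as -> -> ->.
    assert (Hc : 0 < cos alpha) by (apply cos_gt_0; lra).
    assert (Hs : 0 < sin alpha) by (apply sin_gt_0; lra).
    split; [now apply Rmult_lt_0_compat|].
    assert (E := sin2_cos2 theta). unfold Rsqr in E.
    replace (_ + _) with (rho * sin alpha * (rho * sin alpha)
      * (sin theta * sin theta + cos theta * cos theta)) by ring.
    rewrite E, Rmult_1_r. repeat apply Rmult_lt_0_compat; assumption.
  - intros [Hz Hr]. destruct (polar_angle x y Hr) as (theta & Hx & Hy).
    set (r := sqrt (x * x + y * y)) in *.
    assert (Hrp : 0 < r) by now apply sqrt_lt_R0.
    (* Polar coordinates a second time, now in the meridian half-plane with coordinates (z, r). *)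
    destruct (polar_angle z r) as (alpha & Hz' & Hr'); [nra|].
    set (rho := sqrt (z * z + r * r)) in *.
    assert (Hrho : 0 < rho) by (apply sqrt_lt_R0; nra).
    assert (Hc : 0 < cos alpha) by nra. assert (Hs : 0 < sin alpha) by nra.
    (* [alpha] is known only through its positive sine and cosine; [acos (cos alpha)] is its
       representative in (0, pi/2). *)
    exists rho, (acos (cos alpha)), theta.
    assert (Hb := COS_bound alpha).
    assert (E := sin2_cos2 alpha). unfold Rsqr in E.
    assert (Hc1 : cos alpha < 1) by nra.
    split; [exact Hrho|]. split.
    + assert (Ha := acos_bound (cos alpha)).
      assert (Hca : cos (acos (cos alpha)) = cos alpha) by (apply cos_acos; lra).
      split.
      * destruct (Req_dec (acos (cos alpha)) 0) as [H0|]; [|lra].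
        rewrite H0, cos_0 in Hca. lra.
      * destruct (Rlt_or_le (acos (cos alpha)) (PI / 2)) as [|Hle]; trivial.
        assert (cos (acos (cos alpha)) <= 0) by (apply cos_le_0; lra). lra.
    + unfold sph. rewrite cos_acos, sin_acos by lra.
      replace (1 - Rsqr (cos alpha)) with (Rsqr (sin alpha)) by (unfold Rsqr; lra).
      rewrite sqrt_Rsqr by lra. now rewrite <- Hr', <- Hz', <- Hx, <- Hy.
Qed.

Lemma locally_flow_domain (q : R3) : flow_domain q -> locally q flow_domain.
Proof.
  intros Hq. apply flow_domain_iff in Hq. destruct q as [[x y] z].
  assert (Ccx : continuous (fun u : R3 => cx u) (x, y, z)).
  { apply (continuous_comp fst fst); apply continuous_fst. }
  assert (Ccy : continuous (fun u : R3 => cy u) (x, y, z)).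
  { apply (continuous_comp fst snd); [apply continuous_fst | apply continuous_snd]. }
  assert (Ccz : continuous (fun u : R3 => cz u) (x, y, z)) by apply continuous_snd.
  assert (Cr : continuous (fun u : R3 => cx u * cx u + cy u * cy u) (x, y, z)).
  { apply (continuous_plus (fun u : R3 => cx u * cx u) (fun u => cy u * cy u)).
    - exact (continuous_mult (fun u : R3 => cx u) (fun u => cx u) _ Ccx Ccx).
    - exact (continuous_mult (fun u : R3 => cy u) (fun u => cy u) _ Ccy Ccy). }
  apply (filter_imp (fun u => 0 < cz u /\ 0 < cx u * cx u + cy u * cy u)).
  - intros u Hu. now apply flow_domain_iff.
  - apply filter_and.
    + apply (Ccz (fun t => 0 < t)). apply (open_gt 0). apply Hq.
    + apply (Cr (fun t => 0 < t)). apply (open_gt 0). apply Hq.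
Qed.

Lemma flow_domain_sph (rho alpha theta : R) :
  0 < rho -> 0 < alpha < PI / 2 -> flow_domain (sph rho alpha theta).
Proof. intros; exists rho, alpha, theta; auto. Qed.

(** The coordinate curve in [rho] has velocity [e_R]. For the two lemmas that follow the velocities
    are [rho] times [e_alpha] and [rho * sin alpha] times [e_theta]. *)
Lemma is_derive_sph_rho (f : R3 -> R) (rho alpha theta : R) :
  let q := sph rho alpha theta in
  ex_hadamard f q ->
  is_derive (fun t => f (sph t alpha theta)) rho
    (Dx f q * (sin alpha * cos theta) + Dy f q * (sin alpha * sin theta)
     + Dz f q * cos alpha).
Proof.
  intros q Hf.
  apply (ex_hadamard_partials _ _ Hf); [reflexivity| | |];
    auto_derive; trivial; ring.
Qed.

Lemma is_derive_sph_alpha (f : R3 -> R) (rho alpha theta : R) :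
  let q := sph rho alpha theta in
  ex_hadamard f q ->
  is_derive (fun t => f (sph rho t theta)) alpha
    (rho * (Dx f q * (cos alpha * cos theta) + Dy f q * (cos alpha * sin theta)
     + Dz f q * - sin alpha)).
Proof.
  intros q Hf.
  eapply is_derive_eq.
  - apply (ex_hadamard_partials _ _ Hf (fun t => rho * sin t * cos theta)
      (fun t => rho * sin t * sin theta) (fun t => rho * cos t) alpha
      (rho * cos alpha * cos theta) (rho * cos alpha * sin theta)
      (rho * - sin alpha)); [reflexivity| | |]; auto_derive; trivial; ring.
  - ring.
Qed.

Lemma is_derive_sph_theta (f : R3 -> R) (rho alpha theta : R) :
  let q := sph rho alpha theta in
  ex_hadamard f q ->
  is_derive (fun t => f (sph rho alpha t)) theta
    (rho * sin alpha * (Dx f q * - sin theta + Dy f q * cos theta)).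
Proof.
  intros q Hf.
  eapply is_derive_eq.
  - apply (ex_hadamard_partials _ _ Hf (fun t => rho * sin alpha * cos t)
      (fun t => rho * sin alpha * sin t) (fun t => rho * cos alpha) theta
      (rho * sin alpha * - sin theta) (rho * sin alpha * cos theta) 0);
      [reflexivity| | |]; auto_derive; trivial; ring.
  - ring.
Qed.


(** * Vortex fields in the spherical frame *)

Lemma Cn_01_ex_derive (n : nat) (f : R -> R) (x : R) :
  (1 <= n)%nat -> Cn_01 n f -> 0 < x < 1 -> ex_derive f x.
Proof. intros Hn Hf Hx. exact (proj1 (Hf 1%nat Hn x Hx)). Qed.

Lemma cos_alpha_range (alpha : R) : 0 < alpha < PI / 2 ->
  0 < cos alpha < 1 /\ 0 < sin alpha.
Proof.
  intros Ha.
  assert (Hc : 0 < cos alpha) by (apply cos_gt_0; lra).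
  assert (Hs : 0 < sin alpha) by (apply sin_gt_0; lra).
  assert (E := sin2_cos2 alpha). unfold Rsqr in E. repeat split; trivial. nra.
Qed.

(** The factor r^(-b) common to the three velocity components. *)
Definition decay (b rho alpha : R) : R := / Rpower (rho * sin alpha) b.

Lemma decay_pos (b rho alpha : R) : 0 < decay b rho alpha.
Proof. apply Rinv_0_lt_compat, exp_pos. Qed.

Lemma is_derive_decay_rho (b rho alpha : R) :
  0 < rho -> 0 < sin alpha ->
  is_derive (fun t => decay b t alpha) rho (- b / rho * decay b rho alpha).
Proof.
  intros Hr Hs. unfold decay, Rpower.
  assert (0 < rho * sin alpha) by now apply Rmult_lt_0_compat.
  assert (0 < exp (b * ln (rho * sin alpha))) by apply exp_pos.
  auto_derive; [repeat split; lra|]. field. lra.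
Qed.

Lemma is_derive_decay_alpha (b rho alpha : R) :
  0 < rho -> 0 < sin alpha ->
  is_derive (fun t => decay b rho t) alpha
    (- b * cos alpha / sin alpha * decay b rho alpha).
Proof.
  intros Hr Hs. unfold decay, Rpower.
  assert (0 < rho * sin alpha) by now apply Rmult_lt_0_compat.
  assert (0 < exp (b * ln (rho * sin alpha))) by apply exp_pos.
  auto_derive; [repeat split; lra|]. field. lra.
Qed.

(* The components of e_R, e_alpha and e_theta along one fixed Cartesian axis. *)
Definition frame_row (A B : R -> R -> R) (C : R -> R) : Prop :=
  forall alpha theta : R,
    is_derive (fun t => A t theta) alpha (B alpha theta) /\
    is_derive (fun t => B t theta) alpha (- A alpha theta) /\
    is_derive (fun t => A alpha t) theta (sin alpha * C theta) /\
    is_derive (fun t => B alpha t) theta (cos alpha * C theta) /\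
    is_derive C theta (- (sin alpha * A alpha theta + cos alpha * B alpha theta)).

Lemma frame_row_x :
  frame_row (fun a t => sin a * cos t) (fun a t => cos a * cos t) (fun t => - sin t).
Proof.
  intros alpha theta. assert (E := sin2_cos2 alpha). unfold Rsqr in E.
  refine (conj _ (conj _ (conj _ (conj _ _)))); auto_derive; trivial; try ring.
  ring_simplify. rewrite <- (Rmult_1_l (cos theta)) at 1. rewrite <- E. ring.
Qed.

Lemma frame_row_y :
  frame_row (fun a t => sin a * sin t) (fun a t => cos a * sin t) cos.
Proof.
  intros alpha theta. assert (E := sin2_cos2 alpha). unfold Rsqr in E.
  refine (conj _ (conj _ (conj _ (conj _ _)))); auto_derive; trivial; try ring.
  ring_simplify. rewrite <- (Rmult_1_l (sin theta)) at 1. rewrite <- E. ring.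
Qed.

Lemma frame_row_z :
  frame_row (fun a t => cos a) (fun a t => - sin a) (fun t => 0).
Proof.
  intros alpha theta. refine (conj _ (conj _ (conj _ (conj _ _)))); auto_derive; trivial; ring.
Qed.

(** One Cartesian component of the vortex field, stripped of its factor r^(-b); [A], [B], [C] are
    the matching components of the frame vectors. *)
Definition profile (F G Omega : R -> R) (A B : R -> R -> R) (C : R -> R)
  (alpha theta : R) : R :=
  G (cos alpha) * A alpha theta + F (cos alpha) * B alpha theta
  + Omega (cos alpha) * C theta.

(** This and the next two definitions are the spherical components of the convection term, divided
    by [decay] squared over [rho]; what remains depends on [alpha] alone. *)
Definition momentum_R (b : R) (F G Omega : R -> R) (alpha : R) : R :=
  let x := cos alpha in
  - b * G x * G x
  + F x * (- b * x / sin alpha * G x - sin alpha * Derive G x - F x)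
  - Omega x * Omega x.

Definition momentum_alpha (b : R) (F G Omega : R -> R) (alpha : R) : R :=
  let x := cos alpha in
  - b * G x * F x
  + F x * (- b * x / sin alpha * F x - sin alpha * Derive F x + G x)
  - x / sin alpha * (Omega x * Omega x).

Definition momentum_theta (b : R) (F G Omega : R -> R) (alpha : R) : R :=
  let x := cos alpha in
  (1 - b) * G x * Omega x + (1 - b) * x / sin alpha * F x * Omega x
  - sin alpha * F x * Derive Omega x.

(** The divergence of the field, divided by [decay] over [rho]. *)
Definition continuity_defect (b : R) (F G : R -> R) (alpha : R) : R :=
  let x := cos alpha in
  (2 - b) * G x + (1 - b) * x / sin alpha * F x - sin alpha * Derive F x.

Section Component.

Variables (b : R) (F G Omega : R -> R) (rho alpha theta : R).
Hypotheses (Hrho : 0 < rho) (Halpha : 0 < alpha < PI / 2).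
Hypotheses (HF : ex_derive F (cos alpha)) (HG : ex_derive G (cos alpha))
  (HO : ex_derive Omega (cos alpha)).
Variables (A B : R -> R -> R) (C : R -> R).
Hypothesis Hrow : frame_row A B C.

Lemma is_derive_comp_cos (h : R -> R) :
  ex_derive h (cos alpha) ->
  is_derive (fun t => h (cos t)) alpha (- sin alpha * Derive h (cos alpha)).
Proof.
  intros H. eapply is_derive_eq.
  - apply (is_derive_Rcomp h cos); [now apply Derive_correct|].
    auto_derive; trivial; reflexivity.
  - ring.
Qed.

Lemma is_derive_component_rho :
  is_derive (fun t => decay b t alpha * profile F G Omega A B C alpha theta) rho
    (- b / rho * decay b rho alpha * profile F G Omega A B C alpha theta).
Proof.
  destruct (cos_alpha_range alpha Halpha) as [_ Hs].
  eapply is_derive_eq.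
  - apply is_derive_Rmult; [now apply is_derive_decay_rho | apply (is_derive_const (V := R_NormedModule))].
  - unfold zero; simpl. ring.
Qed.

Lemma is_derive_component_alpha :
  is_derive (fun t => decay b rho t * profile F G Omega A B C t theta) alpha
    (let x := cos alpha in
     decay b rho alpha *
     (- b * x / sin alpha * profile F G Omega A B C alpha theta
      - sin alpha * (Derive G x * A alpha theta + Derive F x * B alpha theta
                     + Derive Omega x * C theta)
      + G x * B alpha theta - F x * A alpha theta)).
Proof.
  destruct (cos_alpha_range alpha Halpha) as [_ Hs].
  destruct (Hrow alpha theta) as (HA & HB & _).
  eapply is_derive_eq.
  - unfold profile. apply is_derive_Rmult; [now apply is_derive_decay_alpha|].
    apply is_derive_Rplus; [apply is_derive_Rplus|];
      (apply is_derive_Rmult; [apply is_derive_comp_cos; assumption|]).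
    + exact HA.
    + exact HB.
    + apply (is_derive_const (V := R_NormedModule)).
  - unfold zero, profile; simpl. ring.
Qed.

Lemma is_derive_component_theta :
  is_derive (fun t => decay b rho alpha * profile F G Omega A B C alpha t) theta
    (let x := cos alpha in
     decay b rho alpha *
     (G x * sin alpha * C theta + F x * cos alpha * C theta
      - Omega x * (sin alpha * A alpha theta + cos alpha * B alpha theta))).
Proof.
  destruct (Hrow alpha theta) as (_ & _ & HA & HB & HC).
  eapply is_derive_eq.
  - apply is_derive_scal. unfold profile.
    apply is_derive_Rplus; [apply is_derive_Rplus|]; apply is_derive_scal.
    + exact HA.
    + exact HB.
    + exact HC.
  - simpl. ring.
Qed.

End Component.

Lemma vortex_form_components (b : R) (F G Omega : R -> R) (v : R3 -> R3)
  (rho alpha theta : R) :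
  has_vortex_form b F G Omega v -> 0 < rho -> 0 < alpha < PI / 2 ->
  let P := profile F G Omega in
  cx (v (sph rho alpha theta)) = decay b rho alpha
    * P (fun a t => sin a * cos t) (fun a t => cos a * cos t) (fun t => - sin t) alpha theta /\
  cy (v (sph rho alpha theta)) = decay b rho alpha
    * P (fun a t => sin a * sin t) (fun a t => cos a * sin t) cos alpha theta /\
  cz (v (sph rho alpha theta)) = decay b rho alpha
    * P (fun a t => cos a) (fun a t => - sin a) (fun t => 0) alpha theta.
Proof.
  intros Hv Hr Ha P. rewrite (Hv rho alpha theta Hr Ha).
  unfold P, profile, decay, e_R, e_alpha, e_theta, cx, cy, cz, plus, scal; simpl.
  unfold plus, scal; simpl. unfold mult; simpl. unfold Rdiv.
  repeat split; ring.
Qed.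

(** * Differentiability of vortex fields in Cartesian coordinates *)

Definition axis_dist (u : R3) : R := sqrt (cx u * cx u + cy u * cy u).
Definition radius (u : R3) : R := sqrt (cx u * cx u + cy u * cy u + cz u * cz u).

Lemma axis_dist_sph (rho alpha theta : R) :
  0 < rho -> 0 < alpha < PI / 2 ->
  axis_dist (sph rho alpha theta) = rho * sin alpha.
Proof.
  intros Hr Ha. destruct (cos_alpha_range alpha Ha) as [_ Hs].
  unfold axis_dist, sph, cx, cy; simpl.
  assert (E := sin2_cos2 theta). unfold Rsqr in E.
  replace (_ + _) with (rho * sin alpha * (rho * sin alpha)
    * (sin theta * sin theta + cos theta * cos theta)) by ring.
  rewrite E, Rmult_1_r. apply sqrt_square. apply Rlt_le, Rmult_lt_0_compat; lra.
Qed.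

Lemma radius_sph (rho alpha theta : R) :
  0 < rho -> radius (sph rho alpha theta) = rho.
Proof.
  intros Hr. unfold radius, sph, cx, cy, cz; simpl.
  assert (E := sin2_cos2 theta). assert (E' := sin2_cos2 alpha). unfold Rsqr in *.
  replace (_ + _) with (rho * rho * (sin alpha * sin alpha
    * (sin theta * sin theta + cos theta * cos theta) + cos alpha * cos alpha)) by ring.
  rewrite E, Rmult_1_r, E', Rmult_1_r. apply sqrt_square. lra.
Qed.

Lemma ex_hadamard_opp (f : R3 -> R) (q : R3) :
  ex_hadamard f q -> ex_hadamard (fun u => - f u) q.
Proof.
  intros Hf. apply (ex_hadamard_comp Ropp); [|exact Hf].
  auto_derive; trivial.
Qed.

Lemma ex_hadamard_div (f g : R3 -> R) (q : R3) :
  g q <> 0 -> ex_hadamard f q -> ex_hadamard g q ->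
  ex_hadamard (fun u => f u / g u) q.
Proof.
  intros H Hf Hg. apply (ex_hadamard_mult f (fun u => / g u)); [exact Hf|].
  apply (ex_hadamard_comp Rinv); [|exact Hg]. auto_derive; trivial.
Qed.

Section Cartesian.

Variable q : R3.
Hypothesis Hq : flow_domain q.

Lemma axis_dist_pos : 0 < axis_dist q.
Proof. apply sqrt_lt_R0. now apply flow_domain_iff. Qed.

Lemma radius_pos : 0 < radius q.
Proof. apply sqrt_lt_R0. apply flow_domain_iff in Hq. nra. Qed.

Lemma ex_hadamard_axis_dist : ex_hadamard axis_dist q.
Proof.
  apply (ex_hadamard_comp sqrt).
  - apply flow_domain_iff in Hq. auto_derive. lra.
  - apply (ex_hadamard_plus (fun u => cx u * cx u) (fun u => cy u * cy u));
      apply ex_hadamard_mult; first [apply ex_hadamard_cx | apply ex_hadamard_cy].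
Qed.

Lemma ex_hadamard_radius : ex_hadamard radius q.
Proof.
  apply (ex_hadamard_comp sqrt).
  - apply flow_domain_iff in Hq. auto_derive. nra.
  - apply (ex_hadamard_plus (fun u => cx u * cx u + cy u * cy u) (fun u => cz u * cz u));
      [apply (ex_hadamard_plus (fun u => cx u * cx u) (fun u => cy u * cy u))|];
      apply ex_hadamard_mult;
      first [apply ex_hadamard_cx | apply ex_hadamard_cy | apply ex_hadamard_cz].
Qed.

Lemma ex_hadamard_cos_alpha : ex_hadamard (fun u => cz u / radius u) q.
Proof.
  apply (ex_hadamard_div cz radius).
  - apply Rgt_not_eq, radius_pos.
  - apply ex_hadamard_cz.
  - apply ex_hadamard_radius.
Qed.

Lemma ex_hadamard_sin_alpha : ex_hadamard (fun u => axis_dist u / radius u) q.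
Proof.
  apply (ex_hadamard_div axis_dist radius).
  - apply Rgt_not_eq, radius_pos.
  - apply ex_hadamard_axis_dist.
  - apply ex_hadamard_radius.
Qed.

Lemma ex_hadamard_cos_theta : ex_hadamard (fun u => cx u / axis_dist u) q.
Proof.
  apply (ex_hadamard_div cx axis_dist).
  - apply Rgt_not_eq, axis_dist_pos.
  - apply ex_hadamard_cx.
  - apply ex_hadamard_axis_dist.
Qed.

Lemma ex_hadamard_sin_theta : ex_hadamard (fun u => cy u / axis_dist u) q.
Proof.
  apply (ex_hadamard_div cy axis_dist).
  - apply Rgt_not_eq, axis_dist_pos.
  - apply ex_hadamard_cy.
  - apply ex_hadamard_axis_dist.
Qed.

(** On the open domain [f] coincides with sums, products and compositions of differentiable
    functions. Taking the frame components [A], [B], [C] as functions on R^3 leaves no angle in the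
    formula. *)
Lemma ex_hadamard_component (b : R) (F G Omega : R -> R) (f A B C : R3 -> R) :
  (forall x, 0 < x < 1 -> ex_derive F x /\ ex_derive G x /\ ex_derive Omega x) ->
  (forall u, flow_domain u -> f u = / Rpower (axis_dist u) b *
     (G (cz u / radius u) * A u + F (cz u / radius u) * B u
      + Omega (cz u / radius u) * C u)) ->
  ex_hadamard A q -> ex_hadamard B q -> ex_hadamard C q -> ex_hadamard f q.
Proof.
  intros Hreg Hf HA HB HC.
  assert (Hx : 0 < cz q / radius q < 1).
  { destruct Hq as (rho & alpha & theta & Hr & Ha & E). rewrite E, radius_sph by exact Hr.
    replace (cz (sph rho alpha theta) / rho) with (cos alpha)
      by (unfold sph, cz; simpl; field; lra).
    now destruct (cos_alpha_range alpha Ha). }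
  destruct (Hreg _ Hx) as (EF & EG & EO).
  assert (Hp := axis_dist_pos).
  apply (ex_hadamard_ext_loc (fun u => / Rpower (axis_dist u) b *
     (G (cz u / radius u) * A u + F (cz u / radius u) * B u
      + Omega (cz u / radius u) * C u))).
  - apply (filter_imp flow_domain); [|now apply locally_flow_domain].
    intros u Hu. now rewrite Hf.
  - apply (ex_hadamard_mult (fun u => / Rpower (axis_dist u) b)
      (fun u => G (cz u / radius u) * A u + F (cz u / radius u) * B u
      + Omega (cz u / radius u) * C u)).
    + apply (ex_hadamard_comp (fun t => / Rpower t b)); [|apply ex_hadamard_axis_dist].
      unfold Rpower. auto_derive. split; [exact Hp|]. split; trivial.
      apply Rgt_not_eq, exp_pos.
    + apply (ex_hadamard_plus
        (fun u => G (cz u / radius u) * A u + F (cz u / radius u) * B u)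
        (fun u => Omega (cz u / radius u) * C u));
      [apply (ex_hadamard_plus (fun u => G (cz u / radius u) * A u)
        (fun u => F (cz u / radius u) * B u))|].
      * apply (ex_hadamard_mult (fun u => G (cz u / radius u)) A); trivial.
        apply (ex_hadamard_comp G (fun u => cz u / radius u)); [exact EG|].
        apply ex_hadamard_cos_alpha.
      * apply (ex_hadamard_mult (fun u => F (cz u / radius u)) B); trivial.
        apply (ex_hadamard_comp F (fun u => cz u / radius u)); [exact EF|].
        apply ex_hadamard_cos_alpha.
      * apply (ex_hadamard_mult (fun u => Omega (cz u / radius u)) C); trivial.
        apply (ex_hadamard_comp Omega (fun u => cz u / radius u)); [exact EO|].
        apply ex_hadamard_cos_alpha.
Qed.

(** The sines and cosines of both angles are ratios of [cx], [cy], [cz], [axis_dist] and [radius],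
    so no branch of the meridian angle has to be chosen. *)
Lemma ex_hadamard_vortex (b : R) (F G Omega : R -> R) (v : R3 -> R3) :
  (forall x, 0 < x < 1 -> ex_derive F x /\ ex_derive G x /\ ex_derive Omega x) ->
  has_vortex_form b F G Omega v ->
  ex_hadamard (fun u => cx (v u)) q /\ ex_hadamard (fun u => cy (v u)) q /\
  ex_hadamard (fun u => cz (v u)) q.
Proof.
  intros Hreg Hv.
  assert (Hct := ex_hadamard_cos_theta). assert (Hst := ex_hadamard_sin_theta).
  assert (Hca := ex_hadamard_cos_alpha). assert (Hsa := ex_hadamard_sin_alpha).
  assert (Hcart : forall rho alpha theta, 0 < rho -> 0 < alpha < PI / 2 ->
    let u := sph rho alpha theta in
    cz u / radius u = cos alpha /\ axis_dist u / radius u = sin alpha /\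
    cx u / axis_dist u = cos theta /\ cy u / axis_dist u = sin theta /\
    axis_dist u = rho * sin alpha).
  { intros rho alpha theta Hr Ha u. destruct (cos_alpha_range alpha Ha) as [_ Hs].
    unfold u. rewrite axis_dist_sph, radius_sph by assumption.
    unfold sph, cx, cy, cz; simpl. repeat split; field; lra. }
  refine (conj _ (conj _ _)).
  - apply (ex_hadamard_component b F G Omega _
      (fun u => (axis_dist u / radius u) * (cx u / axis_dist u))
      (fun u => (cz u / radius u) * (cx u / axis_dist u))
      (fun u => - (cy u / axis_dist u)) Hreg).
    + intros u (rho & alpha & theta & Hr & Ha & ->).
      destruct (Hcart rho alpha theta Hr Ha) as (-> & -> & -> & -> & ->).
      apply (vortex_form_components b F G Omega v rho alpha theta Hv Hr Ha).
    + now apply ex_hadamard_mult.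
    + now apply ex_hadamard_mult.
    + now apply ex_hadamard_opp.
  - apply (ex_hadamard_component b F G Omega _
      (fun u => (axis_dist u / radius u) * (cy u / axis_dist u))
      (fun u => (cz u / radius u) * (cy u / axis_dist u))
      (fun u => cx u / axis_dist u) Hreg).
    + intros u (rho & alpha & theta & Hr & Ha & ->).
      destruct (Hcart rho alpha theta Hr Ha) as (-> & -> & -> & -> & ->).
      apply (vortex_form_components b F G Omega v rho alpha theta Hv Hr Ha).
    + now apply ex_hadamard_mult.
    + now apply ex_hadamard_mult.
    + exact Hct.
  - apply (ex_hadamard_component b F G Omega _
      (fun u => cz u / radius u) (fun u => - (axis_dist u / radius u))
      (fun u => 0) Hreg).
    + intros u (rho & alpha & theta & Hr & Ha & ->).
      destruct (Hcart rho alpha theta Hr Ha) as (-> & -> & _ & _ & ->).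
      apply (vortex_form_components b F G Omega v rho alpha theta Hv Hr Ha).
    + exact Hca.
    + now apply ex_hadamard_opp.
    + exists 0, 0, 0. intros X Y Z t X' Y' Z' _ _ _ _.
      apply is_derive_eq with 0; [|ring].
      apply (is_derive_const (V := R_NormedModule)).
Qed.

End Cartesian.

(** Each derivative along a coordinate curve is computed twice, by the chain rule from the Cartesian
    partials and directly from the spherical form of [f]; uniqueness of derivatives equates the
    results. *)
Lemma component_partials (b : R) (F G Omega : R -> R) (f : R3 -> R)
  (rho alpha theta : R) (A B : R -> R -> R) (C : R -> R) :
  0 < rho -> 0 < alpha < PI / 2 ->
  ex_derive F (cos alpha) -> ex_derive G (cos alpha) -> ex_derive Omega (cos alpha) ->
  frame_row A B C ->
  (forall rho alpha theta, 0 < rho -> 0 < alpha < PI / 2 ->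
     f (sph rho alpha theta) = decay b rho alpha * profile F G Omega A B C alpha theta) ->
  let q := sph rho alpha theta in
  let k := decay b rho alpha in
  let x := cos alpha in
  ex_hadamard f q ->
  Dx f q * (sin alpha * cos theta) + Dy f q * (sin alpha * sin theta)
     + Dz f q * cos alpha
    = - b / rho * k * profile F G Omega A B C alpha theta /\
  Dx f q * (cos alpha * cos theta) + Dy f q * (cos alpha * sin theta)
     + Dz f q * - sin alpha
    = k / rho * (- b * x / sin alpha * profile F G Omega A B C alpha theta
      - sin alpha * (Derive G x * A alpha theta + Derive F x * B alpha theta
                     + Derive Omega x * C theta)
      + G x * B alpha theta - F x * A alpha theta) /\
  Dx f q * - sin theta + Dy f q * cos theta
    = k / (rho * sin alpha) * (G x * sin alpha * C theta + F x * cos alpha * C theta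
      - Omega x * (sin alpha * A alpha theta + cos alpha * B alpha theta)).
Proof.
  intros Hr Ha HF HG HO Hrow Hf q k x Hq; subst q.
  destruct (cos_alpha_range alpha Ha) as [_ Hs].
  refine (conj _ (conj _ _)).
  - rewrite <- (is_derive_unique _ _ _ (is_derive_sph_rho f rho alpha theta Hq)).
    apply is_derive_unique.
    apply (is_derive_ext_loc (fun t => decay b t alpha * profile F G Omega A B C alpha theta)).
    + apply (filter_imp (fun t => 0 < t)); [|now apply (open_gt 0)].
      intros t Ht. now rewrite Hf.
    + now apply is_derive_component_rho.
  - apply (Rmult_eq_reg_l rho); [|lra].
    rewrite <- (is_derive_unique _ _ _ (is_derive_sph_alpha f rho alpha theta Hq)).
    apply is_derive_unique.
    apply (is_derive_ext_loc (fun t => decay b rho t * profile F G Omega A B C t theta)).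
    + apply (filter_imp (fun t => 0 < t /\ t < PI / 2)).
      * intros t Ht. now rewrite Hf.
      * apply filter_and; [now apply (open_gt 0) | now apply (open_lt (PI / 2))].
    + eapply is_derive_eq; [now apply is_derive_component_alpha|].
      simpl. unfold k, x. field. lra.
  - apply (Rmult_eq_reg_l (rho * sin alpha)).
    2: { apply Rgt_not_eq, Rmult_lt_0_compat; lra. }
    rewrite <- (is_derive_unique _ _ _ (is_derive_sph_theta f rho alpha theta Hq)).
    apply is_derive_unique.
    apply (is_derive_ext_loc (fun t => decay b rho alpha * profile F G Omega A B C alpha t)).
    + apply filter_forall. intros t. now rewrite Hf.
    + eapply is_derive_eq; [now apply is_derive_component_theta|].
      simpl. unfold k, x. field. lra.
Qed.

(** Expanding v in the moving frame turns advection into a combination of the three directional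
    derivatives of [component_partials]. The curvature terms come from differentiating the frame
    vectors. *)
Lemma advect_component (b : R) (F G Omega : R -> R) (v : R3 -> R3) (f : R3 -> R)
  (rho alpha theta : R) (A B : R -> R -> R) (C : R -> R) :
  0 < rho -> 0 < alpha < PI / 2 ->
  ex_derive F (cos alpha) -> ex_derive G (cos alpha) -> ex_derive Omega (cos alpha) ->
  has_vortex_form b F G Omega v ->
  frame_row A B C ->
  (forall rho alpha theta, 0 < rho -> 0 < alpha < PI / 2 ->
     f (sph rho alpha theta) = decay b rho alpha * profile F G Omega A B C alpha theta) ->
  ex_hadamard f (sph rho alpha theta) ->
  advect v f (sph rho alpha theta) = decay b rho alpha * decay b rho alpha / rho *
    (momentum_R b F G Omega alpha * A alpha theta
     + momentum_alpha b F G Omega alpha * B alpha theta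
     + momentum_theta b F G Omega alpha * C theta).
Proof.
  intros Hr Ha HF HG HO Hv Hrow Hf Hq.
  destruct (cos_alpha_range alpha Ha) as [_ Hs].
  destruct (component_partials b F G Omega f rho alpha theta A B C
    Hr Ha HF HG HO Hrow Hf Hq) as (E1 & E2 & E3).
  destruct (vortex_form_components b F G Omega v rho alpha theta Hv Hr Ha)
    as (V1 & V2 & V3).
  unfold advect. rewrite V1, V2, V3. clear V1 V2 V3.
  set (q := sph rho alpha theta) in *. set (k := decay b rho alpha) in *.
  (* Regroup by frame direction instead of by Cartesian axis. *)
  transitivity (k * (G (cos alpha) * (Dx f q * (sin alpha * cos theta)
      + Dy f q * (sin alpha * sin theta) + Dz f q * cos alpha)
    + F (cos alpha) * (Dx f q * (cos alpha * cos theta)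
      + Dy f q * (cos alpha * sin theta) + Dz f q * - sin alpha)
    + Omega (cos alpha) * (Dx f q * - sin theta + Dy f q * cos theta))).
  { unfold profile. ring. }
  rewrite E1, E2, E3. unfold profile, momentum_R, momentum_alpha, momentum_theta.
  field. lra.
Qed.

(** * The Euler equations in spherical coordinates *)

Lemma continuity_equation (b : R) (F G Omega : R -> R) (v : R3 -> R3)
  (rho alpha theta : R) :
  0 < rho -> 0 < alpha < PI / 2 ->
  (forall x, 0 < x < 1 -> ex_derive F x /\ ex_derive G x /\ ex_derive Omega x) ->
  has_vortex_form b F G Omega v ->
  div v (sph rho alpha theta) = 0 -> continuity_defect b F G alpha = 0.
Proof.
  intros Hr Ha Hreg Hv Hdiv.
  destruct (cos_alpha_range alpha Ha) as [Hx Hs].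
  destruct (Hreg _ Hx) as (HF & HG & HO).
  destruct (ex_hadamard_vortex _ (flow_domain_sph rho alpha theta Hr Ha)
    b F G Omega v Hreg Hv) as (Q1 & Q2 & Q3).
  assert (W := fun r a t => vortex_form_components b F G Omega v r a t Hv).
  destruct (component_partials b F G Omega _ rho alpha theta _ _ _ Hr Ha HF HG HO
    frame_row_x (fun r a t hr ha => proj1 (W r a t hr ha)) Q1) as (X1 & X2 & X3).
  destruct (component_partials b F G Omega _ rho alpha theta _ _ _ Hr Ha HF HG HO
    frame_row_y (fun r a t hr ha => proj1 (proj2 (W r a t hr ha))) Q2) as (Y1 & Y2 & Y3).
  destruct (component_partials b F G Omega _ rho alpha theta _ _ _ Hr Ha HF HG HO
    frame_row_z (fun r a t hr ha => proj2 (proj2 (W r a t hr ha))) Q3) as (Z1 & Z2 & Z3).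
  assert (Hk := decay_pos b rho alpha).
  set (q := sph rho alpha theta) in *. set (k := decay b rho alpha) in *.
  unfold div in Hdiv.
  assert (Ea := sin2_cos2 alpha). assert (Et := sin2_cos2 theta). unfold Rsqr in Ea, Et.
  assert (Ca : cos alpha * cos alpha = 1 - sin alpha * sin alpha) by lra.
  assert (Ct : cos theta * cos theta = 1 - sin theta * sin theta) by lra.
  (* The divergence is the trace of the Jacobian in the orthonormal spherical frame. *)
  assert (T : forall x1 x2 x3 y1 y2 y3 z1 z2 z3 : R,
    x1 + y2 + z3 =
    sin alpha * cos theta * (x1 * (sin alpha * cos theta) + x2 * (sin alpha * sin theta) + x3 * cos alpha)
    + sin alpha * sin theta * (y1 * (sin alpha * cos theta) + y2 * (sin alpha * sin theta) + y3 * cos alpha)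
    + cos alpha * (z1 * (sin alpha * cos theta) + z2 * (sin alpha * sin theta) + z3 * cos alpha)
    + cos alpha * cos theta * (x1 * (cos alpha * cos theta) + x2 * (cos alpha * sin theta) + x3 * - sin alpha)
    + cos alpha * sin theta * (y1 * (cos alpha * cos theta) + y2 * (cos alpha * sin theta) + y3 * - sin alpha)
    + - sin alpha * (z1 * (cos alpha * cos theta) + z2 * (cos alpha * sin theta) + z3 * - sin alpha)
    + - sin theta * (x1 * - sin theta + x2 * cos theta)
    + cos theta * (y1 * - sin theta + y2 * cos theta)).
  { intros. ring [Ca Ct]. }
  (* The off-diagonal Jacobian entries do not occur in the divergence, so they are supplied
     explicitly. *)
  rewrite (T _ (Dy (fun u => cx (v u)) q) (Dz (fun u => cx (v u)) q)
    (Dx (fun u => cy (v u)) q) _ (Dz (fun u => cy (v u)) q)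
    (Dx (fun u => cz (v u)) q) (Dy (fun u => cz (v u)) q) _) in Hdiv.
  rewrite X1, X2, X3, Y1, Y2, Y3, Z1, Z2 in Hdiv.
  apply (Rmult_eq_reg_l (k / rho));
    [|apply Rgt_not_eq, Rdiv_lt_0_compat; assumption].
  rewrite Rmult_0_r, <- Hdiv. unfold profile, continuity_defect.
  unfold Rdiv. rewrite Rinv_mult.
  assert (Hw : / sin alpha * sin alpha = 1) by (apply Rinv_l; lra).
  ring [Ca Ct Hw].
Qed.

(** The Cartesian momentum equations are projected on the orthonormal frame; each derivative carries
    the length of the corresponding coordinate velocity, namely 1, [rho] or [rho * sin alpha]. *)
Lemma pressure_derivatives (b : R) (F G Omega : R -> R) (v : R3 -> R3) (p : R3 -> R)
  (rho alpha theta : R) :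
  0 < rho -> 0 < alpha < PI / 2 ->
  (forall x, 0 < x < 1 -> ex_derive F x /\ ex_derive G x /\ ex_derive Omega x) ->
  has_vortex_form b F G Omega v ->
  C1_on flow_domain p ->
  steady_euler_on flow_domain v p ->
  let k := decay b rho alpha in
  is_derive (fun t => p (sph t alpha theta)) rho
    (- (k * k / rho * momentum_R b F G Omega alpha)) /\
  is_derive (fun t => p (sph rho t theta)) alpha
    (- (k * k * momentum_alpha b F G Omega alpha)) /\
  is_derive (fun t => p (sph rho alpha t)) theta
    (- (k * k * sin alpha * momentum_theta b F G Omega alpha)).
Proof.
  intros Hr Ha Hreg Hv Hp Heuler k.
  destruct (cos_alpha_range alpha Ha) as [Hx Hs].
  destruct (Hreg _ Hx) as (HF & HG & HO).
  assert (Hq := flow_domain_sph rho alpha theta Hr Ha).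
  assert (Hph := C1_on_ex_hadamard _ p _ Hp (locally_flow_domain _ Hq)).
  destruct (ex_hadamard_vortex _ Hq b F G Omega v Hreg Hv) as (Q1 & Q2 & Q3).
  assert (W := fun r a t => vortex_form_components b F G Omega v r a t Hv).
  assert (M1 := advect_component b F G Omega v _ rho alpha theta _ _ _ Hr Ha HF HG HO Hv
    frame_row_x (fun r a t hr ha => proj1 (W r a t hr ha)) Q1).
  assert (M2 := advect_component b F G Omega v _ rho alpha theta _ _ _ Hr Ha HF HG HO Hv
    frame_row_y (fun r a t hr ha => proj1 (proj2 (W r a t hr ha))) Q2).
  assert (M3 := advect_component b F G Omega v _ rho alpha theta _ _ _ Hr Ha HF HG HO Hv
    frame_row_z (fun r a t hr ha => proj2 (proj2 (W r a t hr ha))) Q3).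
  destruct (Heuler _ Hq) as [Hm _].
  unfold convection, grad in Hm. rewrite M1, M2, M3 in Hm. clear M1 M2 M3.
  unfold opp in Hm; simpl in Hm. unfold prod_opp, opp in Hm; simpl in Hm.
  injection Hm as P1 P2 P3.
  assert (Ea := sin2_cos2 alpha). assert (Et := sin2_cos2 theta). unfold Rsqr in Ea, Et.
  assert (Ca : cos alpha * cos alpha = 1 - sin alpha * sin alpha) by lra.
  assert (Ct : cos theta * cos theta = 1 - sin theta * sin theta) by lra.
  apply (f_equal Ropp) in P1, P2, P3. rewrite Ropp_involutive in P1, P2, P3.
  refine (conj _ (conj _ _)).
  - eapply is_derive_eq; [now apply is_derive_sph_rho|].
    rewrite <- P1, <- P2, <- P3. fold k. unfold Rdiv. ring [Ca Ct].
  - eapply is_derive_eq; [now apply is_derive_sph_alpha|].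
    rewrite <- P1, <- P2, <- P3. fold k. unfold Rdiv.
    assert (Hw : / rho * rho = 1) by (apply Rinv_l; lra). ring [Ca Ct Hw].
  - eapply is_derive_eq; [now apply is_derive_sph_theta|].
    rewrite <- P1, <- P2. fold k. unfold Rdiv.
    assert (Hw : / rho * rho = 1) by (apply Rinv_l; lra). ring [Ca Ct Hw].
Qed.

(** The meridian derivative of the pressure is a constant [l] on each circle about the axis. Over a
    full turn the pressure returns to its value, so the mean value theorem gives 2 pi l = 0. *)
Lemma momentum_theta_eq_0 (b : R) (F G Omega : R -> R) (v : R3 -> R3) (p : R3 -> R)
  (alpha : R) :
  0 < alpha < PI / 2 ->
  (forall x, 0 < x < 1 -> ex_derive F x /\ ex_derive G x /\ ex_derive Omega x) ->
  has_vortex_form b F G Omega v -> C1_on flow_domain p ->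
  steady_euler_on flow_domain v p ->
  momentum_theta b F G Omega alpha = 0.
Proof.
  intros Ha Hreg Hv Hp Heuler.
  destruct (cos_alpha_range alpha Ha) as [_ Hs].
  set (l := - (decay b 1 alpha * decay b 1 alpha * sin alpha
               * momentum_theta b F G Omega alpha)).
  assert (Hd : forall t, is_derive (fun t => p (sph 1 alpha t)) t l).
  { intros t. apply (pressure_derivatives b F G Omega v p 1 alpha t); trivial. lra. }
  destruct (MVT_gen (fun t => p (sph 1 alpha t)) 0 (2 * PI) (fun _ => l)) as (c & _ & Hc).
  - intros t _. apply Hd.
  - intros t _. apply derivable_continuous_pt. exists l. apply is_derive_Reals, Hd.
  - assert (Hper : sph 1 alpha (2 * PI) = sph 1 alpha 0).
    { unfold sph. now rewrite cos_2PI, sin_2PI, cos_0, sin_0. }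
    rewrite Hper in Hc. assert (Hpi := PI_RGT_0).
    assert (Hl : l = 0).
    { assert (l * (2 * PI - 0) = 0) by lra. nra. }
    unfold l in Hl. assert (Hk := decay_pos b 1 alpha).
    assert (0 < decay b 1 alpha * decay b 1 alpha * sin alpha)
      by (repeat apply Rmult_lt_0_compat; assumption).
    nra.
Qed.

(** * Zeros and constants of functions of one variable *)

Lemma continuous_neq_0 (f : R -> R) (x : R) :
  continuous f x -> f x <> 0 ->
  exists e : R, 0 < e /\ forall t, Rabs (t - x) < e -> f t <> 0.
Proof.
  intros Hc Hx.
  destruct (Hc (fun y => y <> 0) (open_neq 0 _ Hx)) as [e He].
  exists e. split; [apply cond_pos|]. exact He.
Qed.

Lemma first_zero (f : R -> R) (a b : R) :
  a <= b -> (forall x, a <= x <= b -> continuous f x) ->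
  f a <> 0 -> f b = 0 ->
  exists c, a < c <= b /\ f c = 0 /\ forall x, a <= x < c -> f x <> 0.
Proof.
  intros Hab Hcont Ha Hb.
  (* [E] collects the endpoints z for which [f] has no zero on [a, z]; its supremum is the first
     zero. *)
  set (E := fun z => a <= z <= b /\ forall t, a <= t <= z -> f t <> 0).
  assert (HEa : E a).
  { split; [lra|]. intros t Ht. now replace t with a by lra. }
  destruct (completeness E) as [c [Hub Hlub]].
  - exists b. intros z [Hz _]. lra.
  - now exists a.
  - assert (Hac : a <= c) by now apply Hub.
    assert (Hcb : c <= b) by (apply Hlub; intros z [Hz _]; lra).
    assert (Hbelow : forall x, a <= x < c -> f x <> 0).
    { intros x Hx Hfx. apply (Rlt_not_le c x); [lra|].
      apply Hlub. intros z [Hz Hz']. apply Rnot_lt_le. intros Hxz.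
      apply (Hz' x); [lra|exact Hfx]. }
    assert (Hc0 : f c = 0).
    { apply NNPP. intros Hc.
      destruct (continuous_neq_0 f c (Hcont c (conj Hac Hcb)) Hc) as (e & He & Hnz).
      assert (c <> b) by congruence.
      (* If [f c] were nonzero, the supremum could be passed by this amount, small enough to stay
         both near [c] and below [b]. *)
      assert (Hm1 := Rmin_l (e / 2) (b - c)). assert (Hm2 := Rmin_r (e / 2) (b - c)).
      assert (Hm3 : 0 < Rmin (e / 2) (b - c)) by (apply Rmin_glb_lt; lra).
      assert (HE : E (c + Rmin (e / 2) (b - c))).
      { split; [lra|]. intros t Ht. destruct (Rlt_or_le t c).
        - apply Hbelow; lra.
        - apply Hnz. rewrite Rabs_pos_eq; lra. }
      apply Hub in HE. lra. }
    exists c. repeat split; trivial.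
    destruct (Req_dec a c) as [E0|]; [|lra]. subst c. contradiction.
Qed.

(** Reflection t -> -t turns the last zero into a first one. *)
Lemma last_zero (f : R -> R) (a b : R) :
  a <= b -> (forall x, a <= x <= b -> continuous f x) ->
  f a = 0 -> f b <> 0 ->
  exists c, a <= c < b /\ f c = 0 /\ forall x, c < x <= b -> f x <> 0.
Proof.
  intros Hab Hcont Ha Hb.
  destruct (first_zero (fun t => f (- t)) (- b) (- a)) as (c & Hc & Hc0 & Hnz).
  - lra.
  - intros x Hx. apply (continuous_comp Ropp f); [|apply Hcont; lra].
    apply (continuous_opp (fun t : R => t)), continuous_id.
  - now rewrite Ropp_involutive.
  - now rewrite Ropp_involutive.
  - exists (- c). repeat split; [lra|lra|exact Hc0|].
    intros x Hx. rewrite <- (Ropp_involutive x). apply Hnz. lra.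
Qed.

Lemma constant_of_derive_0 (h : R -> R) (a b : R) :
  (forall x, a < x < b -> is_derive h x 0) ->
  forall x y, a < x < b -> a < y < b -> h x = h y.
Proof.
  intros Hd.
  assert (H : forall x y, a < x < b -> a < y < b -> x < y -> h x = h y).
  { intros x y Hx Hy Hxy. apply (eq_is_derive h x y); trivial.
    intros t Ht. apply Hd. lra. }
  intros x y Hx Hy. destruct (Rtotal_order x y) as [|[->|]]; trivial.
  - now apply H.
  - symmetry. now apply H.
Qed.

Lemma filterlim_right_constant (h : R -> R) (a b k l : R) :
  a < b -> (forall x, a < x < b -> h x = k) ->
  filterlim h (at_right a) (locally l) -> k = l.
Proof.
  intros Hab Hk Hl.
  apply (filterlim_locally_unique (F := at_right a) h k l); [|exact Hl].
  apply (filterlim_ext_loc (fun _ => k)); [|apply filterlim_const].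
  assert (Hb : 0 < b - a) by lra. exists (mkposreal _ Hb).
  intros y Hy Hay. symmetry. apply Hk.
  change (Rabs (y - a) < b - a) in Hy. apply Rabs_def2 in Hy. lra.
Qed.

Lemma filterlim_left_constant (h : R -> R) (a b k l : R) :
  a < b -> (forall x, a < x < b -> h x = k) ->
  filterlim h (at_left b) (locally l) -> k = l.
Proof.
  intros Hab Hk Hl.
  apply (filterlim_locally_unique (F := at_left b) h k l); [|exact Hl].
  apply (filterlim_ext_loc (fun _ => k)); [|apply filterlim_const].
  assert (Hb : 0 < b - a) by lra. exists (mkposreal _ Hb).
  intros y Hy Hay. symmetry. apply Hk.
  change (Rabs (y - b) < b - a) in Hy. apply Rabs_def2 in Hy. lra.
Qed.

Lemma continuous_at_left (f : R -> R) (c : R) :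
  continuous f c -> filterlim f (at_left c) (locally (f c)).
Proof.
  intros H. apply (filterlim_filter_le_1 (G := at_left c) (F := locally c) f); [|exact H].
  apply filter_le_within.
Qed.

(** * The reduced equations *)

Lemma acos_range (x : R) : 0 < x < 1 ->
  0 < acos x < PI / 2 /\ cos (acos x) = x /\ sin (acos x) = sqrt (1 - x ^ 2).
Proof.
  intros Hx. assert (Hb := acos_bound x).
  assert (Hc : cos (acos x) = x) by (apply cos_acos; lra).
  split; [split|split; trivial].
  - destruct (Req_dec (acos x) 0) as [H0|]; [|lra]. rewrite H0, cos_0 in Hc. lra.
  - destruct (Rlt_or_le (acos x) (PI / 2)) as [|Hle]; trivial.
    assert (cos (acos x) <= 0) by (apply cos_le_0; lra). lra.
  - rewrite sin_acos by lra. f_equal. unfold Rsqr. ring.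
Qed.

Lemma sqrt_1_minus_sqr (x : R) : 0 < x < 1 ->
  0 < sqrt (1 - x ^ 2) /\ sqrt (1 - x ^ 2) * sqrt (1 - x ^ 2) = 1 - x ^ 2.
Proof.
  intros Hx. split; [apply sqrt_lt_R0; nra | apply sqrt_sqrt; nra].
Qed.

(** The pressure is eliminated without mixed second derivatives: the radial equation is integrated
    between radii 1 and 2, and the resulting pressure difference is differentiated in [alpha] and
    compared with the polar equation. *)
Lemma pure_swirl_equation (b : R) (F G Omega : R -> R) (v : R3 -> R3) (p : R3 -> R)
  (l x : R) :
  0 < b -> 0 <= l < x -> x < 1 ->
  (forall x, 0 < x < 1 -> ex_derive F x /\ ex_derive G x /\ ex_derive Omega x) ->
  has_vortex_form b F G Omega v -> C1_on flow_domain p ->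
  steady_euler_on flow_domain v p ->
  (forall y, l < y < 1 -> F y = 0 /\ G y = 0) ->
  Omega x * Derive Omega x = 0.
Proof.
  intros Hb Hl Hx1 Hreg Hv Hp Heuler Hzero.
  destruct (acos_range x) as (Ha & Hcos & _); [lra|].
  set (alpha := acos x) in *.
  destruct (cos_alpha_range alpha Ha) as [_ Hs].
  assert (HM : forall a, l < cos a < 1 ->
    momentum_R b F G Omega a = - (Omega (cos a) * Omega (cos a)) /\
    momentum_alpha b F G Omega a = - (cos a / sin a * (Omega (cos a) * Omega (cos a)))).
  { intros a Hca. destruct (Hzero _ Hca) as [Z1 Z2].
    unfold momentum_R, momentum_alpha. rewrite Z1, Z2. split; ring. }
  assert (Hdiff : forall a, 0 < a < PI / 2 -> l < cos a < 1 ->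
    p (sph 2 a 0) - p (sph 1 a 0) =
    / (2 * b) * ((decay b 1 a * decay b 1 a - decay b 2 a * decay b 2 a)
    * (Omega (cos a) * Omega (cos a)))).
  { intros a Ha' Hca. destruct (cos_alpha_range a Ha') as [_ Hs'].
    (* For a pure swirl the radial derivative of p is k^2 Omega^2 / rho, with k = [decay], while
       that of k^2 is -2 b k^2 / rho. Hence p + k^2 Omega^2 / (2 b) does not change with the
       radius. *)
    assert (Heq : p (sph 1 a 0) + / (2 * b) * (decay b 1 a * decay b 1 a)
        * (Omega (cos a) * Omega (cos a)) =
      p (sph 2 a 0) + / (2 * b) * (decay b 2 a * decay b 2 a)
        * (Omega (cos a) * Omega (cos a))).
    { apply (eq_is_derive (fun t => p (sph t a 0) + / (2 * b) * (decay b t a * decay b t a)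
        * (Omega (cos a) * Omega (cos a))) 1 2); [|lra].
      intros t Ht. assert (Ht0 : 0 < t) by lra.
      destruct (pressure_derivatives b F G Omega v p t a 0 Ht0 Ha' Hreg Hv Hp Heuler)
        as [Dp _].
      destruct (HM a Hca) as [E1 _]. rewrite E1 in Dp.
      assert (Dk := is_derive_decay_rho b t a Ht0 Hs').
      eapply is_derive_eq.
      - apply is_derive_Rplus; [exact Dp|].
        apply is_derive_Rmult; [|apply (is_derive_const (V := R_NormedModule))].
        apply is_derive_scal. apply is_derive_Rmult; exact Dk.
      - unfold zero; simpl. field. lra. }
    replace (/ (2 * b) * ((decay b 1 a * decay b 1 a - decay b 2 a * decay b 2 a)
      * (Omega (cos a) * Omega (cos a)))) with
      (/ (2 * b) * (decay b 1 a * decay b 1 a) * (Omega (cos a) * Omega (cos a))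
       - / (2 * b) * (decay b 2 a * decay b 2 a) * (Omega (cos a) * Omega (cos a)))
      by ring.
    lra. }
  assert (Hcx : l < cos alpha < 1) by lra.
  destruct (HM alpha Hcx) as [_ E2].
  assert (D1 : forall t, 0 < t -> is_derive (fun a => p (sph t a 0)) alpha
    (decay b t alpha * decay b t alpha * (cos alpha / sin alpha
      * (Omega (cos alpha) * Omega (cos alpha))))).
  { intros t Ht.
    destruct (pressure_derivatives b F G Omega v p t alpha 0 Ht Ha Hreg Hv Hp Heuler)
      as (_ & Dp & _).
    eapply is_derive_eq; [exact Dp|]. rewrite E2. ring. }
  assert (DO : is_derive (fun a => Omega (cos a)) alpha
    (- sin alpha * Derive Omega (cos alpha))).
  { apply is_derive_comp_cos. apply Hreg. lra. }
  assert (DK : forall t, 0 < t -> is_derive (fun a => decay b t a * decay b t a) alpha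
    (- 2 * b * cos alpha / sin alpha * (decay b t alpha * decay b t alpha))).
  { intros t Ht. eapply is_derive_eq.
    - apply is_derive_Rmult; now apply is_derive_decay_alpha.
    - field. lra. }
  assert (H1 : 0 < 1) by lra. assert (H2 : 0 < 2) by lra.
  (* [L] and [DR] differentiate the two sides of [Hdiff] in [alpha], the left by the polar momentum
     equation and the right by the product rule. *)
  assert (L := is_derive_Rplus _ _ _ _ _ (D1 2 H2) (is_derive_Ropp _ _ _ (D1 1 H1))).
  assert (DR := is_derive_scal _ _ (/ (2 * b)) _ (is_derive_Rmult _ _ _ _ _
    (is_derive_Rplus _ _ _ _ _ (DK 1 H1) (is_derive_Ropp _ _ _ (DK 2 H2)))
    (is_derive_Rmult _ _ _ _ _ DO DO))).
  apply is_derive_unique in DR.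
  assert (DR' : Derive (fun a => / (2 * b) * ((decay b 1 a * decay b 1 a
      + - (decay b 2 a * decay b 2 a)) * (Omega (cos a) * Omega (cos a)))) alpha =
    decay b 2 alpha * decay b 2 alpha *
        (cos alpha / sin alpha * (Omega (cos alpha) * Omega (cos alpha))) +
        - (decay b 1 alpha * decay b 1 alpha *
         (cos alpha / sin alpha * (Omega (cos alpha) * Omega (cos alpha))))).
  { apply is_derive_unique. eapply is_derive_ext_loc; [|exact L].
    apply (filter_imp (fun a => (0 < a /\ a < PI / 2) /\ (l < cos a /\ cos a < 1))).
    - intros a [Ha1 Ha2]. exact (Hdiff a Ha1 Ha2).
    - assert (Ccos : continuous cos alpha)
        by (eapply is_derive_continuous; auto_derive; trivial; reflexivity).
      apply filter_and; apply filter_and.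
      + now apply (open_gt 0).
      + now apply (open_lt (PI / 2)).
      + apply (Ccos (fun y => l < y)). now apply (open_gt l).
      + apply (Ccos (fun y => y < 1)). now apply (open_lt 1). }
  rewrite DR in DR'. clear DR L.
  rewrite Hcos in *.
  assert (Hlt : decay b 2 alpha < decay b 1 alpha).
  { unfold decay. apply Rinv_lt_contravar.
    - apply Rmult_lt_0_compat; apply exp_pos.
    - apply Rlt_Rpower_l; lra. }
  assert (Hk2 := decay_pos b 2 alpha).
  set (k1 := decay b 1 alpha) in *. set (k2 := decay b 2 alpha) in *.
  (* The terms in Omega^2 cancel, leaving Omega Omega' with a factor that is positive because
     [k2 < k1]. *)
  assert (Hprod : (k1 * k1 - k2 * k2) * sin alpha / b * (Omega x * Derive Omega x) = 0).
  { transitivity (k2 * k2 * (x / sin alpha * (Omega x * Omega x)) +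
       - (k1 * k1 * (x / sin alpha * (Omega x * Omega x)))
     - / (2 * b) *
     ((-2 * b * x / sin alpha * (k1 * k1) + - (-2 * b * x / sin alpha * (k2 * k2))) *
      (Omega x * Omega x) +
      (k1 * k1 + - (k2 * k2)) *
      (- sin alpha * Derive Omega x * Omega x + Omega x * (- sin alpha * Derive Omega x)))).
    - field. lra.
    - rewrite DR'. ring. }
  apply Rmult_integral in Hprod. destruct Hprod as [H0|H0]; [|exact H0].
  assert (0 < (k1 * k1 - k2 * k2) * sin alpha / b).
  { apply Rdiv_lt_0_compat; [|exact Hb]. apply Rmult_lt_0_compat; [nra|exact Hs]. }
  lra.
Qed.

(** [continuity_defect], and below it [momentum_theta], set to zero in the variable x = cos alpha,
    where s is sin alpha. *)
Definition reduced_continuity (b : R) (F G : R -> R) (x : R) : Prop :=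
  let s := sqrt (1 - x ^ 2) in
  (2 - b) * G x + (1 - b) * x / s * F x - s * Derive F x = 0.

Definition reduced_swirl (b : R) (F G Omega : R -> R) (x : R) : Prop :=
  let s := sqrt (1 - x ^ 2) in
  (1 - b) * G x * Omega x + (1 - b) * x / s * F x * Omega x
  - s * F x * Derive Omega x = 0.

(** * Vanishing of the meridional flow *)

Lemma filterlim_Rmult {T : Type} (D : (T -> Prop) -> Prop) {FD : Filter D}
  (f g : T -> R) (a b : R) :
  filterlim f D (locally a) -> filterlim g D (locally b) ->
  filterlim (fun x => f x * g x) D (locally (a * b)).
Proof.
  intros Hf Hg. apply (filterlim_comp_2 f g Rmult Hf Hg).
  apply (filterlim_mult (K := R_AbsRing) a b).
Qed.

(** At b = 2 the coefficient of [G] is zero, and what remains is a linear equation for [F] alone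
    which makes F^2 / (1 - x^2) constant. Its limit at the ground is 0. *)
Lemma meridional_zero_b2 (F G : R -> R) :
  (forall x, 0 < x < 1 -> ex_derive F x) ->
  (forall x, 0 < x < 1 -> reduced_continuity 2 F G x) ->
  filterlim F (at_right 0) (locally 0) ->
  forall x, 0 < x < 1 -> F x = 0.
Proof.
  intros Hreg Hc Hlim x Hx.
  set (h := fun t => F t * F t * / (1 - t ^ 2)).
  assert (Hd : forall t, 0 < t < 1 -> is_derive h t 0).
  { intros t Ht. assert (H1 : 0 < 1 - t ^ 2) by nra.
    assert (DF := Derive_correct _ _ (Hreg t Ht)).
    destruct (sqrt_1_minus_sqr t Ht) as [Hs Hs2].
    assert (E := Hc t Ht). unfold reduced_continuity in E.
    assert (DF' : Derive F t = - t / (1 - t ^ 2) * F t).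
    { rewrite <- Hs2. apply (Rmult_eq_reg_l (sqrt (1 - t ^ 2))); [|lra].
      transitivity ((1 - 2) * t / sqrt (1 - t ^ 2) * F t); [lra|]. field. lra. }
    eapply is_derive_eq.
    - apply is_derive_Rmult; [apply is_derive_Rmult; exact DF|].
      instantiate (1 := 2 * t / (1 - t ^ 2) ^ 2).
      auto_derive; [lra|]. field. lra.
    - rewrite DF'. field. lra. }
  assert (Hh : filterlim h (at_right 0) (locally 0)).
  { assert (C : filterlim (fun t : R => / (1 - t ^ 2)) (at_right 0) (locally 1)).
    { assert (K : continuous (fun t : R => / (1 - t ^ 2)) 0).
      { apply (ex_derive_continuous (fun t : R => / (1 - t ^ 2))). auto_derive. lra. }
      unfold continuous in K. replace (/ (1 - 0 ^ 2)) with 1 in K by field.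
      refine (filterlim_filter_le_1 _ _ K). apply filter_le_within. }
    assert (L := filterlim_Rmult _ _ _ _ _ (filterlim_Rmult _ _ _ _ _ Hlim Hlim) C).
    now rewrite !Rmult_0_l in L. }
  assert (H01 : 0 < 1) by lra.
  assert (Hx0 : h x = 0).
  { apply (filterlim_right_constant h 0 1 (h x) 0 H01); [|exact Hh].
    intros y Hy. now apply (constant_of_derive_0 h 0 1 Hd). }
  unfold h in Hx0.
  assert (H1 : 0 < / (1 - x ^ 2)) by (apply Rinv_0_lt_compat; nra).
  apply Rmult_integral in Hx0. destruct Hx0 as [H0|H0]; [|lra].
  apply Rmult_integral in H0. tauto.
Qed.

(** With x = cos alpha this is sin alpha to the power 1 - b. *)
Definition weight (b x : R) : R := Rpower (1 - x ^ 2) ((1 - b) / 2).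

Lemma is_derive_weight (b x : R) : 0 < x < 1 ->
  is_derive (weight b) x ((b - 1) * x / (1 - x ^ 2) * weight b x).
Proof.
  intros Hx. assert (H : 0 < 1 - x ^ 2) by nra.
  eapply is_derive_eq.
  - apply (is_derive_Rcomp (fun u => Rpower u ((1 - b) / 2)) (fun t => 1 - t ^ 2) x
      ((1 - b) / 2 / (1 - x ^ 2) * weight b x) (- 2 * x)).
    + unfold weight, Rpower. auto_derive; [lra|]. field. lra.
    + auto_derive; trivial. ring.
  - field. lra.
Qed.

(** A base in (0,1) is raised to a nonpositive power. The bound lets Omega^2 be estimated by the
    squared angular momentum. *)
Lemma weight_ge_1 (b x : R) : 1 <= b -> 0 < x < 1 -> 1 <= weight b x.
Proof.
  intros Hb Hx. unfold weight, Rpower. rewrite <- exp_0 at 1.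
  assert (H : ln (1 - x ^ 2) <= 0) by (rewrite <- ln_1; apply ln_le; nra).
  destruct (Req_dec ((1 - b) / 2 * ln (1 - x ^ 2)) 0) as [->|Hn]; [lra|].
  apply Rlt_le, exp_increasing. nra.
Qed.

(* With f = F * weight (the Stokes stream function) and g = Omega * weight (the
   angular momentum), transport of g along the streamlines makes g^2 a constant
   multiple of (f^2)^k as long as f does not vanish. *)
Lemma circulation_power_law (b : R) (F G Omega : R -> R) (y c : R) :
  b <> 2 -> 0 < y -> c <= 1 ->
  (forall x, 0 < x < 1 -> ex_derive F x /\ ex_derive Omega x) ->
  (forall x, 0 < x < 1 -> reduced_continuity b F G x /\ reduced_swirl b F G Omega x) ->
  (forall x, y <= x < c -> F x <> 0) ->
  let f x := F x * weight b x in
  let g x := Omega x * weight b x in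
  let k := (b - 1) / (b - 2) in
  exists K, 0 <= K /\ forall x, y < x < c -> g x * g x = K * Rpower (f x * f x) k.
Proof.
  intros Hb Hy Hc1 Hreg Heq HF f g k.
  destruct (Rlt_or_le y c) as [Hyc|Hcy].
  2: { exists 0. split; [lra|]. intros x Hx. lra. }
  (* The candidate constant. Squaring f keeps the base of [Rpower] positive whatever the sign of
     f. *)
  set (h := fun x => g x * g x * Rpower (f x * f x) (- k)).
  assert (Hff : forall x, y <= x < c -> 0 < f x * f x).
  { intros x Hx. assert (f x <> 0).
    { apply Rmult_integral_contrapositive. split; [now apply HF|].
      apply Rgt_not_eq, exp_pos. }
    nra. }
  assert (Hd : forall x, y < x < c -> is_derive h x 0).
  { intros x Hx. assert (Hx01 : 0 < x < 1) by lra.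
    destruct (Hreg x Hx01) as [EF EO].
    destruct (Heq x Hx01) as [Q1 Q2]. unfold reduced_continuity, reduced_swirl in *.
    destruct (sqrt_1_minus_sqr x Hx01) as [Hs Hs2].
    assert (Hfx : 0 < f x * f x) by (apply Hff; lra).
    assert (HFx : F x <> 0) by (apply HF; lra).
    assert (Hw : 0 < weight b x) by apply exp_pos.
    assert (DW := is_derive_weight b x Hx01).
    assert (Df := is_derive_Rmult _ _ _ _ _ (Derive_correct _ _ EF) DW).
    assert (Dg := is_derive_Rmult _ _ _ _ _ (Derive_correct _ _ EO) DW).
    fold f in Df. fold g in Dg.
    set (f' := Derive F x * weight b x + F x * ((b - 1) * x / (1 - x ^ 2) * weight b x)) in *.
    set (g' := Derive Omega x * weight b x + Omega x * ((b - 1) * x / (1 - x ^ 2) * weight b x)) in *.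
    (* Continuity gives f' = (2 - b) G weight / s, and the swirl equation gives g' f = (1 - b) G
       Omega weight^2 / s; the exponent [k] is the ratio that eliminates [G]. *)
    assert (Hkey : g' * f x = k * g x * f').
    { set (s := sqrt (1 - x ^ 2)) in *.
      assert (EF' : Derive F x = ((2 - b) * G x + (1 - b) * x / s * F x) / s).
      { apply (Rmult_eq_reg_l s); [|lra].
        transitivity ((2 - b) * G x + (1 - b) * x / s * F x); [lra|]. field. lra. }
      assert (EO' : Derive Omega x * F x = ((1 - b) * G x * Omega x
         + (1 - b) * x / s * F x * Omega x) / s).
      { apply (Rmult_eq_reg_l s); [|lra].
        transitivity ((1 - b) * G x * Omega x + (1 - b) * x / s * F x * Omega x);
          [lra|]. field. lra. }
      unfold g', f', f, g. rewrite EF', <- Hs2.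
      transitivity (weight b x * weight b x * (Derive Omega x * F x
        + Omega x * F x * ((b - 1) * x / (s * s)))); [ring|].
      rewrite EO'. unfold k. field. lra. }
    assert (DP : is_derive (fun t => Rpower (f t * f t) (- k)) x
      (- k * (2 * f' / f x) * Rpower (f x * f x) (- k))).
    { assert (f x <> 0) by nra.
      eapply is_derive_eq.
      - apply (is_derive_Rcomp (fun u => Rpower u (- k)) (fun t => f t * f t) x
          (- k / (f x * f x) * Rpower (f x * f x) (- k))).
        + unfold Rpower. auto_derive; [lra|]. field. lra.
        + apply is_derive_Rmult; exact Df.
      - field. trivial. }
    eapply is_derive_eq.
    - apply is_derive_Rmult; [apply is_derive_Rmult; exact Dg|exact DP].
    - assert (f x <> 0) by nra.
      transitivity (2 * g x * Rpower (f x * f x) (- k) / f x * (g' * f x - k * g x * f')).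
      + field. trivial.
      + rewrite Hkey. ring. }
  exists (h ((y + c) / 2)). split.
  - unfold h. assert (0 < Rpower (f ((y + c) / 2) * f ((y + c) / 2)) (- k)) by apply exp_pos.
    assert (0 <= g ((y + c) / 2) * g ((y + c) / 2)) by nra. nra.
  - intros x Hx. rewrite (constant_of_derive_0 h y c Hd _ x) by lra.
    unfold h. rewrite Rmult_assoc, <- Rpower_plus.
    replace (- k + k) with 0 by ring.
    rewrite Rpower_O by (apply Hff; lra). ring.
Qed.

(** For b > 2 the exponent of the power law is positive, so g^2 tends to 0 together with f; since
    the weight is at least 1, Omega^2 is at most g^2. *)
Lemma swirl_vanishes_with_stream (b : R) (F G Omega : R -> R) (y c : R) :
  2 < b -> 0 < y < c -> c <= 1 ->
  (forall x, 0 < x < 1 -> ex_derive F x /\ ex_derive Omega x) ->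
  (forall x, 0 < x < 1 -> reduced_continuity b F G x /\ reduced_swirl b F G Omega x) ->
  (forall x, y <= x < c -> F x <> 0) ->
  filterlim (fun x => F x * weight b x) (at_left c) (locally 0) ->
  filterlim Omega (at_left c) (locally 0).
Proof.
  intros Hb [Hy Hyc] Hc1 Hreg Heq HF Hlim.
  assert (Hb2 : b <> 2) by lra.
  destruct (circulation_power_law b F G Omega y c Hb2 Hy Hc1 Hreg Heq HF)
    as (K & HK & Hlaw).
  set (k := (b - 1) / (b - 2)) in *.
  assert (Hk : 0 < k) by (apply Rdiv_lt_0_compat; lra).
  apply (filterlim_locally (F := at_left c) Omega 0). intros eps.
  assert (He := cond_pos eps).
  (* Chosen so that d^k = eps^2 / (K + 1); the denominator K + 1 also covers K = 0. *)
  set (d := Rpower (eps * eps / (K + 1)) (/ k)).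
  assert (Hd : 0 < sqrt d) by apply sqrt_lt_R0, exp_pos.
  assert (Hdd : sqrt d * sqrt d = d) by (apply sqrt_sqrt, Rlt_le, exp_pos).
  assert (Hee : 0 < eps * eps / (K + 1)) by (apply Rdiv_lt_0_compat; nra).
  assert (L := proj1 (filterlim_locally (F := at_left c) _ 0) Hlim (mkposreal _ Hd)).
  assert (N : at_left c (fun x => y < x < c)).
  { assert (Hp : 0 < c - y) by lra. exists (mkposreal _ Hp).
    intros x Hx Hxc. change (Rabs (x - c) < c - y) in Hx. apply Rabs_def2 in Hx. lra. }
  generalize (filter_and _ _ L N). apply filter_imp. intros x [H1 Hx].
  change (Rabs (F x * weight b x - 0) < sqrt d) in H1.
  change (Rabs (Omega x - 0) < eps). rewrite Rminus_0_r in *.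
  assert (Hw := weight_ge_1 b x ltac:(lra) ltac:(lra)).
  specialize (Hlaw x Hx). simpl in Hlaw.
  set (f := F x * weight b x) in *.
  assert (Hf : f <> 0).
  { apply Rmult_integral_contrapositive. split; [apply HF|]; lra. }
  assert (Hf2 : f * f < d).
  { rewrite <- Hdd. apply Rabs_def2 in H1. nra. }
  assert (HR : Rpower (f * f) k < eps * eps / (K + 1)).
  { replace (eps * eps / (K + 1)) with (Rpower d k).
    - apply Rlt_Rpower_l; [exact Hk|]. split; [nra|exact Hf2].
    - unfold d. rewrite Rpower_mult, Rinv_l, Rpower_1 by lra. reflexivity. }
  assert (HRp : 0 < Rpower (f * f) k) by apply exp_pos.
  assert (Hlt : (K + 1) * Rpower (f * f) k < eps * eps).
  { apply (Rmult_lt_compat_l (K + 1)) in HR; [|lra].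
    replace ((K + 1) * (eps * eps / (K + 1))) with (eps * eps) in HR by (field; lra).
    exact HR. }
  assert (HO : Omega x * Omega x <= Omega x * weight b x * (Omega x * weight b x)).
  { replace (Omega x * weight b x * (Omega x * weight b x)) with
      (Omega x * Omega x * (weight b x * weight b x)) by ring.
    assert (0 <= Omega x * Omega x) by exact (Rle_0_sqr (Omega x)).
    assert (1 <= weight b x * weight b x) by nra.
    rewrite <- (Rmult_1_r (Omega x * Omega x)) at 1.
    now apply Rmult_le_compat_l. }
  apply Rabs_def1; nra.
Qed.

(** If F x were nonzero, move from x towards the axis up to the first zero c of F, or up to c = 1 if
    there is none. The stream function tends to 0 at c, hence so does Omega, which contradicts Omega
    c <> 0 or Comega <> 0. *)
Lemma meridional_zero_near_axis (b : R) (F G Omega : R -> R) (Comega l : R) :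
  2 <= b -> Comega <> 0 -> 0 <= l ->
  (forall x, 0 < x < 1 -> ex_derive F x /\ ex_derive Omega x) ->
  (forall x, 0 < x < 1 -> reduced_continuity b F G x /\ reduced_swirl b F G Omega x) ->
  filterlim F (at_right 0) (locally 0) ->
  filterlim Omega (at_left 1) (locally Comega) ->
  (b <> 2 -> filterlim (fun x => F x * weight b x) (at_left 1) (locally 0)) ->
  (forall x, l < x < 1 -> Omega x <> 0) ->
  forall x, l < x < 1 -> F x = 0.
Proof.
  intros Hb HC Hl Hreg Heq H0 H1 Hf1 HO x Hx.
  destruct (Req_dec b 2) as [->|Hb2].
  { apply (meridional_zero_b2 F G); [|intros t Ht; now apply Heq|exact H0|lra].
    intros t Ht. now apply Hreg. }
  assert (Hbgt : 2 < b) by lra.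
  apply NNPP. intros HFx.
  destruct (classic (exists z, x <= z < 1 /\ F z = 0)) as [(z & Hz & HFz)|Hnz].
  - destruct (first_zero F x z) as (c & Hc & HFc & Hne); trivial; [lra| |].
    { intros t Ht. apply (ex_derive_continuous F). apply Hreg. lra. }
    assert (Hc01 : 0 < c < 1) by lra. destruct (Hreg c Hc01) as [EF EO].
    apply (HO c); [lra|].
    apply (filterlim_locally_unique (F := at_left c) Omega).
    + apply continuous_at_left, (ex_derive_continuous Omega), EO.
    + apply (swirl_vanishes_with_stream b F G Omega x c); trivial; [lra|lra|].
      (* Here c < 1, so the weight is continuous at c and the zero of F carries over to the stream
         function. *)
      assert (L := filterlim_Rmult _ _ _ _ _
        (continuous_at_left F c (ex_derive_continuous F c EF))
        (continuous_at_left (weight b) c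
          (is_derive_continuous _ _ _ (is_derive_weight b c Hc01)))).
      now rewrite HFc, Rmult_0_l in L.
  (* No zero up to the axis: the prescribed limit of [F * weight] at 1 takes the role of the
     zero. *)
  - apply HC. apply (filterlim_locally_unique (F := at_left 1) Omega); [exact H1|].
    apply (swirl_vanishes_with_stream b F G Omega x 1); trivial; [lra|lra| |auto].
    intros t Ht HFt. apply Hnz. now exists t.
Qed.

(** With F = 0 the swirl equation reads (1 - b) G Omega = 0, so G = 0 where Omega has no zero. The
    flow is then a pure swirl, [HP] gives Omega' = 0, and the limit at the axis fixes the
    constant. *)
Lemma swirl_constant_near_axis (b : R) (F G Omega : R -> R) (Comega l : R) :
  1 < b -> 0 <= l ->
  (forall x, 0 < x < 1 -> ex_derive Omega x) ->
  (forall x, 0 < x < 1 -> reduced_swirl b F G Omega x) ->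
  (forall x, l < x < 1 -> (forall y, l < y < 1 -> F y = 0 /\ G y = 0) ->
     Omega x * Derive Omega x = 0) ->
  filterlim Omega (at_left 1) (locally Comega) ->
  (forall x, l < x < 1 -> Omega x <> 0) ->
  (forall x, l < x < 1 -> F x = 0) ->
  forall x, l < x < 1 -> G x = 0 /\ Omega x = Comega.
Proof.
  intros Hb Hl Hreg Heq HP H1 HO HF.
  assert (HG : forall x, l < x < 1 -> G x = 0).
  { intros x Hx. assert (E := Heq x ltac:(lra)). unfold reduced_swirl in E.
    rewrite (HF x Hx) in E. assert (HOx := HO x Hx).
    assert (E' : (1 - b) * Omega x * G x = 0) by lra.
    apply Rmult_integral in E'. destruct E' as [E'|]; trivial.
    apply Rmult_integral in E'. destruct E'; [lra|contradiction]. }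
  intros x Hx. split; [now apply HG|].
  apply (filterlim_left_constant Omega l 1); [lra| |exact H1].
  intros y Hy. apply (constant_of_derive_0 Omega l 1); trivial.
  intros t Ht. eapply is_derive_eq; [apply Derive_correct, Hreg; lra|].
  assert (E : Omega t * Derive Omega t = 0) by (apply HP; auto).
  apply Rmult_integral in E. destruct E as [E|]; trivial.
  now apply HO in E.
Qed.

(** * Propagation from the axis to the ground *)

Theorem mainTheorem4 (b : R) (hb : 2 <= b) (Comega : R) (hC : Comega <> 0)
  (F G Omega : R -> R) (v : R3 -> R3) (p : R3 -> R)
  (hsol : classical_vortex_solution b F G Omega v p)
  (hF0 : F 0 = 0)
  (hFcont : filterlim F (at_right 0) (locally (F 0)))
  (hOmega : filterlim Omega (at_left 1) (locally Comega))
  (hF1 : b <> 2 ->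
     filterlim (fun x => F x * Rpower (1 - x ^ 2) ((1 - b) / 2))
       (at_left 1) (locally 0)) :
  forall x : R, 0 < x < 1 -> F x = 0 /\ G x = 0 /\ Omega x = Comega.
Proof.
  destruct hsol as (Hv & CF & CG & CO & Hp & Heuler).
  rewrite hF0 in hFcont.
  assert (Hreg : forall x, 0 < x < 1 ->
    ex_derive F x /\ ex_derive G x /\ ex_derive Omega x).
  { intros x Hx. refine (conj _ (conj _ _));
      [apply (Cn_01_ex_derive 3) | apply (Cn_01_ex_derive 2) | apply (Cn_01_ex_derive 1)];
      trivial; lia. }
  assert (Heq : forall x, 0 < x < 1 ->
    reduced_continuity b F G x /\ reduced_swirl b F G Omega x).
  { intros x Hx. destruct (acos_range x Hx) as (Ha & Hc & Hs).
    unfold reduced_continuity, reduced_swirl. rewrite <- Hs. split.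
    - assert (E : continuity_defect b F G (acos x) = 0).
      (* The reduced equation depends on [alpha] only, so one point with this polar angle suffices:
         radius 1, meridian angle 0. *)
      { assert (H1 : 0 < 1) by lra.
        apply (continuity_equation b F G Omega v 1 (acos x) 0); trivial.
        apply Heuler. now apply flow_domain_sph. }
      unfold continuity_defect in E. now rewrite Hc in E.
    - assert (E := momentum_theta_eq_0 b F G Omega v p (acos x) Ha Hreg Hv Hp Heuler).
      unfold momentum_theta in E. now rewrite Hc in E. }
  assert (HregO : forall x, 0 < x < 1 -> ex_derive Omega x) by (intros; now apply Hreg).
  (* The conclusion holds on every interval (l, 1) on which Omega has no zero. *)
  assert (Hnear : forall l, 0 <= l -> (forall x, l < x < 1 -> Omega x <> 0) ->
    forall x, l < x < 1 -> F x = 0 /\ G x = 0 /\ Omega x = Comega).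
  { intros l Hl HO.
    assert (HF : forall x, l < x < 1 -> F x = 0).
    { apply (meridional_zero_near_axis b F G Omega Comega l); trivial.
      intros x Hx. split; now apply Hreg. }
    intros x Hx. split; [now apply HF|]. revert x Hx.
    apply (swirl_constant_near_axis b F G Omega Comega l); trivial; [lra| |].
    - intros x Hx. now apply Heq.
    - intros x Hx HFG.
      apply (pure_swirl_equation b F G Omega v p l); trivial; lra. }
  assert (HO : forall x, 0 < x < 1 -> Omega x <> 0).
  { intros y Hy HOy.
    destruct (hOmega (fun t => t <> 0) (open_neq 0 _ hC)) as [d Hd].
    assert (Hdp := cond_pos d).
    (* A point strictly between y and 1, and within d / 2 of the axis, so that Omega has no zero on
       [z, 1). *)
    set (z := Rmax ((1 + y) / 2) (1 - d / 2)).
    assert (Z1 : (1 + y) / 2 <= z) by apply Rmax_l.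
    assert (Z2 : 1 - d / 2 <= z) by apply Rmax_r.
    assert (Z3 : z < 1) by (apply Rmax_lub_lt; lra).
    assert (Hnz : forall t, z <= t < 1 -> Omega t <> 0).
    { intros t Ht. apply Hd; [|lra]. change (Rabs (t - 1) < d).
      rewrite Rabs_left by lra. lra. }
    destruct (last_zero Omega y z) as (m & Hm & HOm & Hafter); trivial; [lra| | |].
    - intros t Ht. apply (ex_derive_continuous Omega), HregO. lra.
    - apply Hnz. lra.
    - assert (Hgt : forall t, m < t < 1 -> Omega t <> 0).
      { intros t Ht. destruct (Rle_or_lt t z); [apply Hafter | apply Hnz]; lra. }
      assert (Hm01 : 0 < m < 1) by lra.
      (* Just to the right of its last zero m, Omega equals Comega, so continuity at m forces Comega
         = Omega m = 0. *)
      apply hC. rewrite <- HOm.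
      apply (filterlim_right_constant Omega m 1 Comega (Omega m)); [lra| |].
      + intros t Ht. apply (Hnear m ltac:(lra) Hgt t Ht).
      + refine (filterlim_filter_le_1 _ _ (ex_derive_continuous Omega m (HregO m Hm01))).
        apply filter_le_within. }
  intros x Hx. exact (Hnear 0 (Rle_refl 0) HO x Hx).
Qed.
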